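(* The Lie group $(E_{7,\mathbb{R}})^{\mathbb{C}}$ is isomorphic to the Lie group $Sp(3,\mathbb{H}^{\mathbb{C}})$: $(E_{7,\mathbb{R}})^{\mathbb{C}}\cong Sp(3,\mathbb{H}^{\mathbb{C}})$.
   Context: $\mathbb{H}^{\mathbb{C}}=\mathbb{H}\otimes_{\mathbb{R}}\mathbb{C}$ is the complexified quaternion algebra with quaternionic conjugation extended $\mathbb{C}$-linearly, and $Sp(3,\mathbb{H}^{\mathbb{C}})=\{A\in M(3,\mathbb{H}^{\mathbb{C}})\mid AA^*=E\}$, where $A^*$ is the transpose of the entrywise quaternionic conjugate. Let $(\mathfrak{J}_{\mathbb{R}})^{\mathbb{C}}$ be the space of symmetric $3\times3$ complex matrices with $X\circ Y=\frac12(XY+YX)$, $(X,Y)=\mathrm{tr}(X\circ Y)$, and $X\times Y=\frac12\bigl(2X\circ Y-\mathrm{tr}(X)Y-\mathrm{tr}(Y)X+(\mathrm{tr}(X)\mathrm{tr}(Y)-(X,Y))E\bigr)$. Let $(\mathfrak{e}_{6,\mathbb{R}})^{\mathbb{C}}=\{\phi\in\mathrm{Hom}_{\mathbb{C}}((\mathfrak{J}_{\mathbb{R}})^{\mathbb{C}})\mid(\phi X,X\times X)=0\ \forall X\}$ ($\mathrm{Hom}_{\mathbb{C}}(V)$ denotes $\mathbb{C}$-linear endomorphisms of $V$); ${}^t\phi$ is the transpose with respect to $(X,Y)$. For $X\in(\mathfrak{J}_{\mathbb{R}})^{\mathbb{C}}$ let $\tilde X Z=X\circ Z$, and set $X\vee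 W=[\tilde X,\tilde W]+(X\circ W-\frac13(X,W)E)^{\sim}\in(\mathfrak{e}_{6,\mathbb{R}})^{\mathbb{C}}$. Let $(\mathfrak{P}_{\mathbb{R}})^{\mathbb{C}}=(\mathfrak{J}_{\mathbb{R}})^{\mathbb{C}}\oplus(\mathfrak{J}_{\mathbb{R}})^{\mathbb{C}}\oplus\mathbb{C}\oplus\mathbb{C}$. For $\phi\in(\mathfrak{e}_{6,\mathbb{R}})^{\mathbb{C}}$, $A,B\in(\mathfrak{J}_{\mathbb{R}})^{\mathbb{C}}$, $\nu\in\mathbb{C}$, define the linear map $\Phi(\phi,A,B,\nu)$ of $(\mathfrak{P}_{\mathbb{R}})^{\mathbb{C}}$ by $\Phi(\phi,A,B,\nu)(X,Y,\xi,\eta)=(\phi X-\frac13\nu X+2B\times Y+\eta A,\ 2A\times X-{}^t\phi Y+\frac13\nu Y+\xi B,\ (A,Y)+\nu\xi,\ (B,X)-\nu\eta)$. For $P=(X,Y,\xi,\eta)$, $Q=(Z,W,\zeta,\omega)$ define $P\times Q=\Phi(\phi,A,B,\nu)$ with $\phi=-\frac12(X\vee W+Z\vee Y)$, $A=-\frac14(2Y\times W-\xi Z-\zeta X)$, $B=\frac14(2X\times Z-\eta W-\omega Y)$, $\nu=\frac18((X,W)+(Z,Y)-3(\xi\omega+\zeta\eta))$. Define $(E_{7,\mathbb{R}})^{\mathbb{C}}=\{\alpha\in\mathrm{Iso}_{\mathbb{C}}((\mathfrak{P}_{\mathbb{R}})^{\mathbb{C}})\mid\alpha(P\times Q)\alpha^{-1}=\alpha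 P\times\alpha Q\ \forall P,Q\}$, where $\mathrm{Iso}_{\mathbb{C}}(V)$ is the group of $\mathbb{C}$-linear automorphisms of $V$. *)

(* Defs.v *)
From HB Require Import structures.
From mathcomp Require Import all_boot all_order all_algebra.
From mathcomp Require Import complex ring.
From mathcomp Require Import boolp classical_sets reals topology normedtype.
From mathcomp Require Import landau derive.

Set Implicit Arguments.
Unset Strict Implicit.
Unset Printing Implicit Defensive.

Import Order.TTheory GRing.Theory Num.Theory.
Import numFieldNormedType.Exports.

Local Open Scope ring_scope.

(* A group realised inside a finite-dimensional K-vector space.  It is meant
   for groups cut out by polynomial equations in some GL_n(K); for K = C the
   image is then an embedded complex submanifold of the ambient space, and this
   is the Lie group structure. *)
Record linearGroup (K : numFieldType) := LinearGroup {
  lg_sort :> groupType;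
  lg_space : vectType K;
  lg_emb : lg_sort -> lg_space;
  lg_emb_inj : injective lg_emb
}.

Section LieIsomorphism.
Variable K : numFieldType.
Implicit Types G H : linearGroup K.

Local Notation dimg G := (\dim {:lg_space G}).

Definition lg_coord G (x : G) : 'rV[K]_(dimg G) :=
  \row_i coord (vbasis {:lg_space G}) i (lg_emb x).

(* Holomorphic maps between embedded complex submanifolds: those that extend,
   near each point, to a map of the ambient spaces which is K-differentiable
   on a whole neighbourhood. *)
Definition holomorphic G H (f : G -> H) : Prop :=
  forall x : G,
  exists F : 'rV[K]_(dimg G) -> 'rV[K]_(dimg H),
    (\forall y \near lg_coord x, differentiable F y) /\
    (\forall y \near lg_coord x,
        forall z : G, lg_coord z = y -> F y = lg_coord (f z)).

Definition lie_isomorphic G H : Prop :=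
  exists (f : G -> H) (g : H -> G),
    [/\ {morph f : x y / (x * y)%g}, cancel f g, cancel g f,
        holomorphic f & holomorphic g].

End LieIsomorphism.

(* Quaternions a + b i + c j + d k with coefficients a, b, c, d in K, as the
   row vector (a, b, c, d).  For K = C this is H (x)_R C. *)
Definition quat (K : pzRingType) : Type := 'rV[K]_4.

Section Quaternions.
Variable K : numFieldType.

HB.instance Definition _ := Vector.copy (quat K) 'rV[K]_4.
HB.instance Definition _ := Choice.copy (quat K) 'rV[K]_4.

Definition mkquat (a b c d : K) : quat K :=
  \row_(i < 4) [:: a; b; c; d]`_i.

Definition qre (q : quat K) : K := (q : 'rV_4) 0 (inord 0).
Definition qi (q : quat K) : K := (q : 'rV_4) 0 (inord 1).
Definition qj (q : quat K) : K := (q : 'rV_4) 0 (inord 2).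
Definition qk (q : quat K) : K := (q : 'rV_4) 0 (inord 3).

Definition quat_one : quat K := mkquat 1 0 0 0.

(* i^2 = j^2 = k^2 = ijk = -1 *)
Definition quat_mul (p q : quat K) : quat K :=
  mkquat (qre p * qre q - qi p * qi q - qj p * qj q - qk p * qk q)
         (qre p * qi q + qi p * qre q + qj p * qk q - qk p * qj q)
         (qre p * qj q - qi p * qk q + qj p * qre q + qk p * qi q)
         (qre p * qk q + qi p * qj q - qj p * qi q + qk p * qre q).

Definition quat_conj (q : quat K) : quat K :=
  mkquat (qre q) (- qi q) (- qj q) (- qk q).

Lemma qre_mk a b c d : qre (mkquat a b c d) = a.
Proof. by rewrite /qre mxE inordK. Qed.
Lemma qi_mk a b c d : qi (mkquat a b c d) = b.
Proof. by rewrite /qi mxE inordK. Qed.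
Lemma qj_mk a b c d : qj (mkquat a b c d) = c.
Proof. by rewrite /qj mxE inordK. Qed.
Lemma qk_mk a b c d : qk (mkquat a b c d) = d.
Proof. by rewrite /qk mxE inordK. Qed.
Definition qmkE := (qre_mk, qi_mk, qj_mk, qk_mk).

Lemma qreD p q : qre (p + q) = qre p + qre q. Proof. exact: mxE. Qed.
Lemma qiD p q : qi (p + q) = qi p + qi q. Proof. exact: mxE. Qed.
Lemma qjD p q : qj (p + q) = qj p + qj q. Proof. exact: mxE. Qed.
Lemma qkD p q : qk (p + q) = qk p + qk q. Proof. exact: mxE. Qed.
Definition qDE := (qreD, qiD, qjD, qkD).

Lemma qreZ k q : qre (k *: q) = k * qre q. Proof. exact: mxE. Qed.
Lemma qiZ k q : qi (k *: q) = k * qi q. Proof. exact: mxE. Qed.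
Lemma qjZ k q : qj (k *: q) = k * qj q. Proof. exact: mxE. Qed.
Lemma qkZ k q : qk (k *: q) = k * qk q. Proof. exact: mxE. Qed.
Definition qZE := (qreZ, qiZ, qjZ, qkZ).

Lemma quatP (p q : quat K) :
  qre p = qre q -> qi p = qi q -> qj p = qj q -> qk p = qk q -> p = q.
Proof.
move=> h0 h1 h2 h3; apply/rowP => i; rewrite -(inord_val i).
by case: i => -[|[|[|[|//]]]].
Qed.

Fact quat_mulA : associative quat_mul.
Proof. by move=> p q r; apply: quatP; rewrite !qmkE; ring. Qed.
Fact quat_mul1 : left_id quat_one quat_mul.
Proof. by move=> p; apply: quatP; rewrite !qmkE; ring. Qed.
Fact quat_1mul : right_id quat_one quat_mul.
Proof. by move=> p; apply: quatP; rewrite !qmkE; ring. Qed.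
Fact quat_mulDl : left_distributive quat_mul +%R.
Proof. by move=> p q r; apply: quatP; rewrite !(qDE, qmkE); ring. Qed.
Fact quat_mulDr : right_distributive quat_mul +%R.
Proof. by move=> p q r; apply: quatP; rewrite !(qDE, qmkE); ring. Qed.
Fact quat_1neq0 : quat_one != 0.
Proof.
apply/eqP => /(congr1 qre); rewrite qmkE /qre mxE => /eqP.
by rewrite oner_eq0.
Qed.

HB.instance Definition _ := GRing.Zmodule_isNzRing.Build (quat K)
  quat_mulA quat_mul1 quat_1mul quat_mulDl quat_mulDr quat_1neq0.

Lemma quat_mulE (p q : quat K) : p * q = quat_mul p q. Proof. by []. Qed.
Lemma quat_mulZr k (p q : quat K) : p * (k *: q) = k *: (p * q).
Proof. by rewrite !quat_mulE; apply: quatP; rewrite !(qZE, qmkE); ring. Qed.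
Lemma quat_conjD : {morph quat_conj : p q / p + q}.
Proof. by move=> p q; apply: quatP; rewrite !(qDE, qmkE) ?opprD. Qed.
Lemma quat_conj0 : quat_conj 0 = 0.
Proof. by apply: quatP; rewrite !qmkE /qre/qi/qj/qk mxE ?oppr0. Qed.
Lemma quat_conjM p q : quat_conj (p * q) = quat_conj q * quat_conj p.
Proof. by rewrite !quat_mulE; apply: quatP; rewrite !qmkE; ring. Qed.
Lemma quat_conj1 : quat_conj 1 = 1.
Proof. by apply: quatP; rewrite !qmkE ?oppr0. Qed.
Lemma quat_conjK : involutive quat_conj.
Proof. by move=> p; apply: quatP; rewrite !qmkE ?opprK. Qed.

End Quaternions.

Section Sp.
Variables (K : numFieldType) (n : nat).
Implicit Types A B : 'M[quat K]_n.

Definition qadj A : 'M[quat K]_n := (map_mx (@quat_conj K) A)^T.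

Lemma qadjM A B : qadj (A *m B) = qadj B *m qadj A.
Proof.
apply/matrixP => i j; rewrite !mxE.
rewrite (big_morph _ (@quat_conjD K) (@quat_conj0 K)).
by apply: eq_bigr => k _; rewrite !mxE quat_conjM.
Qed.
Lemma qadj1 : qadj 1%:M = 1%:M.
Proof.
apply/matrixP => i j; rewrite !mxE eq_sym.
by case: eqP => _; rewrite ?mulr1n ?mulr0n ?quat_conj1 ?quat_conj0.
Qed.
Lemma qadjK : involutive qadj.
Proof. by move=> A; apply/matrixP => i j; rewrite !mxE quat_conjK. Qed.

Local Notation qspace := {ffun 'I_n * 'I_n -> quat K}.

Let lmulmx A (X : qspace) : qspace := \val (A *m Matrix X).

Let lmulmxE A X i j : lmulmx A X (i, j) = \sum_l A i l * X (l, j).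
Proof. by rewrite -[LHS]/((A *m Matrix X) i j) mxE. Qed.

Let lmulmx_linear A : linear (lmulmx A).
Proof.
move=> k X Y; apply/ffunP => -[i j]; rewrite !ffunE !lmulmxE.
rewrite scaler_sumr -big_split; apply: eq_bigr => l _ /=.
by rewrite !ffunE mulrDr quat_mulZr.
Qed.

Lemma qmulmx1C A B : A *m B = 1%:M -> B *m A = 1%:M.
Proof.
move=> AB1.
pose fL : {linear qspace -> qspace} :=
  HB.pack (lmulmx B) (GRing.isLinear.Build _ _ _ _ _ (lmulmx_linear B)).
have inj : lker (linfun fL) == 0%VS.
  apply/lker0P => X Y; rewrite !lfunE /= => /val_inj e.
  have := congr1 (mulmx A) e; rewrite !mulmxA AB1 !mul1mx.
  by move=> /(congr1 val).
have [X BX1] : exists X, B *m X = 1%:M.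
  exists (Matrix ((linfun fL)^-1%VF (\val (1%:M : 'M[quat K]_n)))).
  apply: val_inj; have := lker0_lfunVK inj (\val (1%:M : 'M[quat K]_n)).
  by rewrite lfunE.
by rewrite -[A]mulmx1 -{1}BX1 [A *m _]mulmxA AB1 mul1mx.
Qed.

Record SpH_type : Type := SpHType {
  SpH_val : 'M[quat K]_n;
  _ : SpH_val *m qadj SpH_val == 1%:M
}.

HB.instance Definition _ := [isSub for SpH_val].
HB.instance Definition _ := [Choice of SpH_type by <:].

Lemma SpHP (A : SpH_type) : \val A *m qadj (\val A) = 1%:M.
Proof. exact/eqP/(valP A). Qed.

Fact SpH_one_proof : (1%:M : 'M[quat K]_n) *m qadj 1%:M == 1%:M.
Proof. by rewrite qadj1 mulmx1. Qed.
Fact SpH_mul_proof (A B : SpH_type) :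
  (\val A *m \val B) *m qadj (\val A *m \val B) == 1%:M.
Proof. by rewrite qadjM -mulmxA [\val B *m _]mulmxA SpHP mul1mx SpHP. Qed.
Fact SpH_inv_proof (A : SpH_type) :
  qadj (\val A) *m qadj (qadj (\val A)) == 1%:M.
Proof. by rewrite qadjK; apply/eqP/qmulmx1C/SpHP. Qed.

Definition SpH_one : SpH_type := SpHType SpH_one_proof.
Definition SpH_mul (A B : SpH_type) : SpH_type := SpHType (SpH_mul_proof A B).
Definition SpH_inv (A : SpH_type) : SpH_type := SpHType (SpH_inv_proof A).

Fact SpH_mulA : associative SpH_mul.
Proof. by move=> A B C; apply: val_inj; rewrite /= mulmxA. Qed.
Fact SpH_mul1 : left_id SpH_one SpH_mul.
Proof. by move=> A; apply: val_inj; rewrite /= mul1mx. Qed.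
Fact SpH_1mul : right_id SpH_one SpH_mul.
Proof. by move=> A; apply: val_inj; rewrite /= mulmx1. Qed.
Fact SpH_mulV : right_inverse SpH_one SpH_inv SpH_mul.
Proof. by move=> A; apply: val_inj; apply: SpHP. Qed.
Fact SpH_mulK : left_inverse SpH_one SpH_inv SpH_mul.
Proof. by move=> A; apply: val_inj; apply/qmulmx1C/SpHP. Qed.

HB.instance Definition _ := isGroup.Build SpH_type
  SpH_mulA SpH_mul1 SpH_1mul SpH_mulK SpH_mulV.

Definition SpH_emb (A : SpH_type) : qspace := \val (\val A).

Fact SpH_emb_inj : injective SpH_emb.
Proof. by move=> A B /val_inj/val_inj. Qed.

Definition SpH : linearGroup K := LinearGroup SpH_emb_inj.

End Sp.

Section JordanAlgebra.
Variable K : numFieldType.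

Definition asym (X : 'M[K]_3) : 'M[K]_3 := X^T - X.
Lemma asym_linear : linear asym.
Proof.
by move=> k X Y; rewrite /asym linearP scalerBr opprD addrACA.
Qed.
HB.instance Definition _ := GRing.isLinear.Build K _ _ _ asym asym_linear.

Definition symv : {vspace 'M[K]_3} := lker (linfun asym).

Lemma symvP (X : 'M[K]_3) : reflect (X^T = X) (X \in symv).
Proof. by rewrite memv_ker lfunE subr_eq0; apply: eqP. Qed.

Definition jordan : Type := subvs_of symv.
HB.instance Definition _ := Vector.on jordan.

Definition Sym (X : 'M[K]_3) (symX : X^T = X) : jordan :=
  Subvs (introT (symvP X) symX).

Implicit Types X Y Z W : jordan.

Lemma jordan_sym X : (vsval X)^T = vsval X.
Proof. exact/symvP/subvsP. Qed.

Fact jmul_proof X Y :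
  (2^-1 *: (vsval X *m vsval Y + vsval Y *m vsval X))^T =
  2^-1 *: (vsval X *m vsval Y + vsval Y *m vsval X).
Proof. by rewrite linearZ /= linearD /= !trmx_mul !jordan_sym addrC. Qed.

Definition jmul X Y : jordan := Sym (jmul_proof X Y).

Definition jtr X : K := \tr (vsval X).
Definition jinner X Y : K := jtr (jmul X Y).
Definition jone : jordan := Sym (trmx1 K 3).

Definition jcross X Y : jordan :=
  2^-1 *: (2 *: jmul X Y - jtr X *: Y - jtr Y *: X +
           (jtr X * jtr Y - jinner X Y) *: jone).

Lemma jmulC : commutative jmul.
Proof. by move=> X Y; apply: val_inj; rewrite /= addrC. Qed.
Lemma jmul_linear X : linear (jmul X).
Proof.
move=> k Y Z; apply: val_inj => /=.
rewrite mulmxDr mulmxDl -scalemxAr -scalemxAl scalerA mulrC -scalerA -scalerDr.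
by rewrite !scalerDr addrACA.
Qed.
HB.instance Definition _ X :=
  GRing.isLinear.Build K jordan jordan _ (jmul X) (jmul_linear X).

Lemma jtr_linear : scalar jtr.
Proof. by move=> k X Y; rewrite /jtr !linearP. Qed.
HB.instance Definition _ := GRing.isLinear.Build K jordan K _ jtr jtr_linear.

Lemma jinner_linear X : scalar (jinner X).
Proof. by move=> k Y Z; rewrite /jinner !linearP. Qed.
HB.instance Definition _ X :=
  GRing.isLinear.Build K jordan K _ (jinner X) (jinner_linear X).

Lemma jinnerC X Y : jinner X Y = jinner Y X.
Proof. by rewrite /jinner jmulC. Qed.

Lemma jinnerE X Y : jinner X Y = \sum_i \sum_j vsval X i j * vsval Y i j.
Proof.
rewrite /jinner /jtr /= linearZ /= linearD /= [\tr (vsval Y *m _)]mxtrace_mulC.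
rewrite -mulr2n -[\tr _ *+ 2]mulr_natl mulrA mulVf ?pnatr_eq0 // mul1r.
apply: eq_bigr => i _; rewrite mxE; apply: eq_bigr => j _.
by rewrite -[in vsval Y j i]jordan_sym mxE.
Qed.

Lemma jcross_linear X : linear (jcross X).
Proof.
move=> k Y Z; rewrite /jcross !linearP /=; apply: val_inj => /=.
by apply/matrixP => i j; rewrite !mxE /= ?mxE /= /GRing.scale /=; ring.
Qed.
HB.instance Definition _ X :=
  GRing.isLinear.Build K jordan jordan _ (jcross X) (jcross_linear X).

Definition inE6 (phi : 'End(jordan)) : Prop :=
  forall X, jinner (phi X) (jcross X X) = 0.

(* The transpose of phi with respect to the trace form, by its entries on the
   symmetrised matrix units; see jtransposeP. *)
Fact junit_proof (i j : 'I_3) :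
  (2^-1 *: (delta_mx i j + delta_mx j i) : 'M[K]_3)^T =
  2^-1 *: (delta_mx i j + delta_mx j i).
Proof. by rewrite linearZ /= linearD /= !trmx_delta addrC. Qed.

Definition junit i j : jordan := Sym (junit_proof i j).

Fact jtranspose_proof (phi : 'End(jordan)) Y :
  (\matrix_(i < 3, j < 3) jinner (phi (junit i j)) Y)^T =
  \matrix_(i < 3, j < 3) jinner (phi (junit i j)) Y.
Proof.
apply/matrixP => i j; rewrite !mxE; congr (jinner (phi _) _).
by apply: val_inj; rewrite /= addrC.
Qed.

Definition jtranspose_fun (phi : 'End(jordan)) Y : jordan :=
  Sym (jtranspose_proof phi Y).

Lemma jtranspose_linear phi : linear (jtranspose_fun phi).
Proof.
move=> k Y Z; apply: val_inj; apply/matrixP => i j.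
by rewrite /= !mxE linearP.
Qed.
HB.instance Definition _ phi := GRing.isLinear.Build K jordan jordan _
  (jtranspose_fun phi) (jtranspose_linear phi).

Definition jtranspose (phi : 'End(jordan)) : 'End(jordan) :=
  linfun (jtranspose_fun phi).

Lemma jordan_decomp X : X = \sum_i \sum_j vsval X i j *: junit i j.
Proof.
pose D i j : 'M[K]_3 := vsval X i j *: delta_mx i j.
pose D' i j : 'M[K]_3 := vsval X i j *: delta_mx j i.
have D'E : \sum_i \sum_j D' i j = vsval X.
  rewrite exchange_big /= [RHS]matrix_sum_delta.
  apply: eq_bigr => i _; apply: eq_bigr => j _.
  by rewrite /D' -[in vsval X j i]jordan_sym mxE.
have E i j : vsval (vsval X i j *: junit i j) = 2^-1 *: (D i j + D' i j).
  by rewrite linearZ /= scalerA mulrC -scalerA scalerDr.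
apply: val_inj; transitivity (\sum_i \sum_j 2^-1 *: (D i j + D' i j)); last first.
  rewrite [RHS]linear_sum; apply: eq_bigr => i _.
  by rewrite [RHS]linear_sum; apply: eq_bigr => j _; rewrite -E.
under [RHS]eq_bigr do rewrite -scaler_sumr big_split.
rewrite -scaler_sumr big_split /= D'E -matrix_sum_delta.
have -> : vsval X + vsval X = 2 *: vsval X by rewrite scaler_nat.
by rewrite scalerA mulVf ?pnatr_eq0 // scale1r.
Qed.

Lemma jtransposeP (phi : 'End(jordan)) X Y :
  jinner (phi X) Y = jinner X (jtranspose phi Y).
Proof.
rewrite [RHS]jinnerE lfunE /= [LHS]jinnerC [in LHS](jordan_decomp X).
rewrite !linear_sum; apply: eq_bigr => i _.
rewrite !linear_sum; apply: eq_bigr => j _.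
by rewrite mxE !linearZ /= jinnerC.
Qed.

Definition jtilde X : 'End(jordan) := linfun (jmul X).

Definition vee X W : 'End(jordan) :=
  (jtilde X \o jtilde W)%VF - (jtilde W \o jtilde X)%VF +
  jtilde (jmul X W - (3^-1 * jinner X W) *: jone).

Lemma vee_inE6 X W : inE6 (vee X W).
Proof.
move=> Z.
have sum3 (F : 'I_3 -> K) : \sum_i F i = F 0 + F 1 + F 2.
  rewrite !big_ord_recl big_ord0 addr0 addrA; congr (F _ + F _ + F _); exact: val_inj.
pose ent (U : jordan) i j : K := vsval U i j.
have s10 U : ent U 1 0 = ent U 0 1 by rewrite /ent -[in LHS]jordan_sym mxE.
have s20 U : ent U 2 0 = ent U 0 2 by rewrite /ent -[in LHS]jordan_sym mxE.
have s21 U : ent U 2 1 = ent U 1 2 by rewrite /ent -[in LHS]jordan_sym mxE.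
have cE U V i j : ent (U + V) i j = ent U i j + ent V i j by exact: mxE.
have nE U i j : ent (- U) i j = - ent U i j by exact: mxE.
have zE k U i j : ent (k *: U) i j = k * ent U i j by exact: mxE.
have eE i j : ent jone i j = (i == j)%:R by exact: mxE.
have mE U V i j : ent (jmul U V) i j = 2^-1 *
    (ent U i 0 * ent V 0 j + ent U i 1 * ent V 1 j + ent U i 2 * ent V 2 j +
    (ent V i 0 * ent U 0 j + ent V i 1 * ent U 1 j + ent V i 2 * ent U 2 j)).
  by rewrite /ent /= !mxE !sum3.
have iE U V : jinner U V = ent U 0 0 * ent V 0 0 + ent U 1 1 * ent V 1 1 +
    ent U 2 2 * ent V 2 2 + 2 * (ent U 0 1 * ent V 0 1) +
    2 * (ent U 0 2 * ent V 0 2) + 2 * (ent U 1 2 * ent V 1 2).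
  by rewrite jinnerE !sum3 -!/(ent _ _ _) !(s10, s20, s21); ring.
have tE U : jtr U = ent U 0 0 + ent U 1 1 + ent U 2 2.
  by rewrite /jtr /mxtrace sum3.
have -> : vee X W Z = jmul X (jmul W Z) - jmul W (jmul X Z) +
    jmul (jmul X W) Z - (3^-1 * jinner X W) *: Z.
  rewrite /vee !(add_lfunE, opp_lfunE, comp_lfunE, lfunE) /= -[RHS]addrA.
  congr (_ + _); rewrite [jmul (_ - _) Z]jmulC linearB /= [jmul Z _]jmulC.
  congr (_ - _).
  rewrite linearZ /=; congr (_ *: _); apply: val_inj => /=.
  rewrite mulmx1 mul1mx -mulr2n -(scaler_nat 2 (vsval Z)) scalerA.
  by rewrite mulVf ?pnatr_eq0 ?scale1r.
rewrite iE /jcross; pose jm := jmul; rewrite -/jm in mE *.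
clearbody ent jm.
rewrite !(cE, nE, zE, eE) /= !mE !s10 !s20 !s21 !iE !tE.
by field.
Qed.

End JordanAlgebra.

Section CrossPreserving.
Variables (K : fieldType) (V : vectType K) (cross : V -> V -> 'End(V)).
Implicit Types a b c : 'End(V).

(* lker a == 0 says that a is injective, hence bijective, on the
   finite-dimensional space V; a^-1 is then its two-sided inverse. *)
Definition preserves a : Prop :=
  lker a == 0%VS /\
  forall x y : V, (a \o cross x y \o a^-1)%VF = cross (a x) (a y).

Lemma lfun_inv_unique b c :
  lker b == 0%VS -> (c \o b = \1)%VF -> (b^-1)%VF = c.
Proof.
move=> kb cb; rewrite -[LHS]comp_lfun1l -cb -comp_lfunA lker0_compfV //.
exact: comp_lfun1r.
Qed.

Lemma preserves1 : preserves \1%VF.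
Proof.
have k1 : lker (\1%VF : 'End(V)) == 0%VS.
  by apply/lker0P => u v; rewrite !lfunE.
split=> // x y; rewrite (lfun_inv_unique k1 (comp_lfun1l _)).
by rewrite comp_lfun1l comp_lfun1r !lfunE.
Qed.

Lemma preserves_comp a b : preserves a -> preserves b -> preserves (a \o b)%VF.
Proof.
move=> [ka ha] [kb hb].
have kab : lker (a \o b)%VF == 0%VS.
  apply/lker0P => u v; rewrite !comp_lfunE.
  by move=> /(lker0P ka)/(lker0P kb).
split=> // x y; rewrite (@lfun_inv_unique _ (b^-1 \o a^-1)%VF kab).
  by rewrite !comp_lfunE -ha -hb !comp_lfunA.
by rewrite comp_lfunA -(comp_lfunA _ _ a) lker0_compVf // comp_lfun1r
  lker0_compVf.
Qed.

Lemma preserves_inv a : preserves a -> preserves (a^-1)%VF.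
Proof.
move=> [ka ha].
have ki : lker (a^-1)%VF == 0%VS.
  apply/lker0P => u v e.
  by rewrite -(lker0_lfunVK ka u) e lker0_lfunVK.
split=> // x y; rewrite (lfun_inv_unique ki (lker0_compfV ka)).
rewrite -{1}(lker0_lfunVK ka x) -{1}(lker0_lfunVK ka y) -ha.
rewrite !comp_lfunA lker0_compVf // comp_lfun1l.
by rewrite -comp_lfunA lker0_compVf // comp_lfun1r.
Qed.

Record cross_aut : Type := CrossAut {
  cross_aut_val : 'End(V);
  _ : `[< preserves cross_aut_val >]
}.

HB.instance Definition _ := [isSub for cross_aut_val].
HB.instance Definition _ := [Choice of cross_aut by <:].

Implicit Types f g : cross_aut.

Lemma cross_autP f : preserves (\val f).
Proof. exact/asboolP/(valP f). Qed.

Fact cross_aut_one_proof : `[< preserves \1%VF >].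
Proof. exact/asboolP/preserves1. Qed.
Fact cross_aut_mul_proof f g : `[< preserves (\val f \o \val g)%VF >].
Proof. exact/asboolP/preserves_comp/cross_autP/cross_autP. Qed.
Fact cross_aut_inv_proof f : `[< preserves ((\val f)^-1)%VF >].
Proof. exact/asboolP/preserves_inv/cross_autP. Qed.

Definition cross_aut_one := CrossAut cross_aut_one_proof.
Definition cross_aut_mul f g := CrossAut (cross_aut_mul_proof f g).
Definition cross_aut_inv f := CrossAut (cross_aut_inv_proof f).

Fact cross_aut_mulA : associative cross_aut_mul.
Proof. by move=> f g h; apply: val_inj; rewrite /= comp_lfunA. Qed.
Fact cross_aut_mul1 : left_id cross_aut_one cross_aut_mul.
Proof. by move=> f; apply: val_inj; rewrite /= comp_lfun1l. Qed.
Fact cross_aut_1mul : right_id cross_aut_one cross_aut_mul.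
Proof. by move=> f; apply: val_inj; rewrite /= comp_lfun1r. Qed.
Fact cross_aut_mulV : left_inverse cross_aut_one cross_aut_inv cross_aut_mul.
Proof.
by move=> f; apply: val_inj; have [kf _] := cross_autP f; apply: lker0_compVf.
Qed.
Fact cross_aut_Vmul : right_inverse cross_aut_one cross_aut_inv cross_aut_mul.
Proof.
by move=> f; apply: val_inj; have [kf _] := cross_autP f; apply: lker0_compfV.
Qed.

HB.instance Definition _ := isGroup.Build cross_aut
  cross_aut_mulA cross_aut_mul1 cross_aut_1mul cross_aut_mulV cross_aut_Vmul.

Definition cross_aut_emb f : 'End(V) := \val f.

Fact cross_aut_emb_inj : injective cross_aut_emb.
Proof. exact: val_inj. Qed.

End CrossPreserving.

Section FreudenthalSpace.
Variable K : numFieldType.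
Local Notation J := (jordan K).

Definition freudenthal : Type := (J * J * K^o * K^o)%type.
HB.instance Definition _ := Vector.on freudenthal.
Local Notation P := freudenthal.

(* The linear map Phi(phi, A, B, nu).  It is written for an arbitrary
   endomorphism phi; pcross only uses it on elements of e_{6,R}, see
   vee_inE6. *)
Definition Phi_fun (phi : 'End(J)) (A B : J) (nu : K) (x : P) : P :=
  let: (X, Y, xi, eta) := x in
  (phi X - (3^-1 * nu) *: X + 2 *: jcross B Y + eta *: A,
   2 *: jcross A X - jtranspose phi Y + (3^-1 * nu) *: Y + xi *: B,
   jinner A Y + nu * xi,
   jinner B X - nu * eta).

Lemma Phi_linear phi A B nu : linear (Phi_fun phi A B nu).
Proof.
move=> k [[[X Y] xi] eta] [[[Z W] zeta] om].
congr (_, _, _, _); rewrite /= ?linearP /=.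
- apply: val_inj => /=; apply/matrixP => i j.
  by rewrite !mxE /= ?mxE /= /GRing.scale /=; ring.
- apply: val_inj => /=; apply/matrixP => i j.
  by rewrite !mxE /= ?mxE /= /GRing.scale /=; ring.
- by rewrite /GRing.scale /=; ring.
- by rewrite /GRing.scale /=; ring.
Qed.
HB.instance Definition _ phi A B nu :=
  GRing.isLinear.Build K P P _ (Phi_fun phi A B nu) (Phi_linear phi A B nu).

Definition Phi (phi : 'End(J)) (A B : J) (nu : K) : 'End(P) :=
  linfun (Phi_fun phi A B nu).

Lemma PhiE phi A B nu x : Phi phi A B nu x = Phi_fun phi A B nu x.
Proof. exact: lfunE. Qed.

Definition pcross (x y : P) : 'End(P) :=
  let: (X, Y, xi, eta) := x in
  let: (Z, W, zeta, om) := y in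
  Phi (- 2^-1 *: (vee X W + vee Z Y))
      (- 4^-1 *: (2 *: jcross Y W - xi *: Z - zeta *: X))
      (4^-1 *: (2 *: jcross X Z - eta *: W - om *: Y))
      (8^-1 * (jinner X W + jinner Z Y - 3 * (xi * om + zeta * eta))).

Definition E7R : linearGroup K := LinearGroup (@cross_aut_emb_inj _ _ pcross).

End FreudenthalSpace.

(* Main.v *)
(* Identify the complexified quaternions with 2 x 2 complex matrices; then
   Sp(3, H^C) becomes the symplectic group of V = C^6, indexed by 'I_3 * bool.
   The Freudenthal space P is the primitive part of the third exterior power of
   V (embf), on which the symplectic group acts by the cube of its standard
   representation (rho).  Under this identification the operator P x Q is, up to
   the factor 1/16, the action of the symmetrised contraction of P and Q in
   S^2 V = sp(V) (emb_pcross, contr_emb), so rho preserves the cross product.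

   Conversely let f preserve the cross product.  Its value at e4 = (0, 0, 0, 1)
   lies on the cone p x p = 0, on which the unipotent and diagonal elements of
   the symplectic group act transitively, so f may be assumed to fix e4, and then
   likewise e3 = (0, 0, 1, 0).  It then preserves the eigenspaces of e3 x e4 and
   commutes with the adjugate X |-> X x X of symmetric matrices; hence it
   sends the diagonal units E_k to rank one matrices v_k v_k^T, and after
   composition with elements of SL_3 it is the identity.

   The matrix M is recovered from rho M by a local rational formula: the cross
   product yields all products of an entry of the first column with any other
   entry, and comparing with a nonzero minor of M, which is cubic, fixes the
   remaining sign. *)
From HB Require Import structures.
Require Import Defs.
From mathcomp Require Import all_boot all_order all_algebra.
From mathcomp Require Import complex ring boolp classical_sets reals topology.
From mathcomp Require Import normedtype functions landau derive.

Set Implicit Arguments.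
Unset Strict Implicit.
Unset Printing Implicit Defensive.

Import Order.TTheory GRing.Theory Num.Theory.
Import numFieldNormedType.Exports.

Local Open Scope ring_scope.

(** The action on the exterior cube is odd: -E acts as -1. Hence the representation is faithful and
    no quotient by a sign appears. The cross product, however, is quadratic in the group element and
    cannot see this sign, which is why recovering a matrix needs cubic data as well. The delicate
    direction is surjectivity. An automorphism is only known to satisfy f (P x Q) f^-1 = f P x f Q;
    invariance of the grading, of the trace form, of X x X and of the determinant must all be
    extracted from this relation, by evaluating suitable operators P x Q on e3 and e4. No dimension
    or connectedness argument is used: each reduction of the stabiliser is made by an explicit
    symplectic matrix. Tensors are plain functions of three indices rather than elements of a
    quotient. Equivariance is then a matter of exchanging sums, and each comparison with the Jordan
    algebra formulas splits into finitely many ring identities in matrix entries. Algebraic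
    closedness supplies two things: a square root, to write a rank one symmetric matrix as v v^T,
    and 'i, to split the quaternions. *)

Local Notation idx := ('I_3 * bool)%type.

(** * Alternating tensors on a symplectic space *)

Section Tensors.
Variable K : comPzRingType.
Implicit Types (M N : idx -> idx -> K) (T U : idx -> idx -> idx -> K).

(* The basis vectors a and star a of V are dual: the symplectic form J takes the
   value sgn a on (a, star a). *)
Definition star (a : idx) : idx := (a.1, ~~ a.2).
Definition sgn (a : idx) : K := if a.2 then -1 else 1.

Lemma starK : involutive star.
Proof. by move=> [i s]; rewrite /star /= negbK. Qed.

Lemma sgn_star a : sgn (star a) = - sgn a.
Proof. by case: a => i []; rewrite /sgn /= ?opprK. Qed.

Lemma sgn_sqr a : sgn a * sgn a = 1.
Proof. by case: a => i []; rewrite /sgn /= ?mulrNN mulr1. Qed.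

(* M^T J M = J *)
Definition sympl M := forall x y,
  \sum_b sgn b * M b x * M (star b) y = if y == star x then sgn x else 0.

Definition mul6 M N : idx -> idx -> K := fun a c => \sum_b M a b * N b c.

(** Invariance of the symplectic form on vectors, in the shape in which a pair of contracted tensor
    slots presents it. *)
Lemma sympl_pairing M f g : sympl M ->
  \sum_b sgn b * ((\sum_x M b x * f x) * (\sum_y M (star b) y * g y))
  = \sum_x sgn x * (f x * g (star x)).
Proof.
move=> sM; transitivity (\sum_x \sum_y f x * g y *
    (\sum_b sgn b * M b x * M (star b) y)).
  under eq_bigr do rewrite mulr_suml mulr_sumr.
  rewrite exchange_big; apply: eq_bigr => x _ /=.
  under eq_bigr do rewrite mulr_sumr mulr_sumr.
  rewrite exchange_big; apply: eq_bigr => y _ /=.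
  by rewrite mulr_sumr; apply: eq_bigr => b _; ring.
apply: eq_bigr => x _; under eq_bigr do rewrite sM.
rewrite (bigD1 (star x)) //= eqxx big1 ?addr0; first by ring.
by move=> y /negPf ->; rewrite mulr0.
Qed.

Lemma sympl_mul M N : sympl M -> sympl N -> sympl (mul6 M N).
Proof.
move=> sM sN x y; under eq_bigr do rewrite -mulrA.
rewrite (sympl_pairing (fun z => N z x) (fun z => N z y) sM) -sN.
by apply: eq_bigr => b _; rewrite mulrA.
Qed.

Definition one6 (a b : idx) : K := (a == b)%:R.

Lemma sympl_one : sympl one6.
Proof.
move=> x y; rewrite (bigD1 x) //= big1 ?addr0 /one6; last first.
  by move=> b /negPf ->; rewrite mulr0 mul0r.
by rewrite eqxx mulr1 eq_sym; case: eqP => _; rewrite (mulr1, mulr0).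
Qed.

Definition act1 M T : idx -> idx -> idx -> K := fun a b c => \sum_x M a x * T x b c.
Definition act2 M T : idx -> idx -> idx -> K := fun a b c => \sum_x M b x * T a x c.
Definition act3 M T : idx -> idx -> idx -> K := fun a b c => \sum_x M c x * T a b x.
Definition cube M T := act1 M (act2 M (act3 M T)).
Definition der M T : idx -> idx -> idx -> K :=
  fun a b c => act1 M T a b c + act2 M T a b c + act3 M T a b c.

Lemma sum_mulC (I : finType) (f g : I -> K) (F : I -> I -> K) :
  \sum_x f x * (\sum_y g y * F x y) = \sum_y g y * (\sum_x f x * F x y).
Proof.
under eq_bigr do rewrite mulr_sumr; rewrite exchange_big; apply: eq_bigr => y _ /=.
by rewrite mulr_sumr; apply: eq_bigr => x _; rewrite mulrCA.
Qed.

Lemma act12C M N T : act1 M (act2 N T) = act2 N (act1 M T).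
Proof. by apply/funext => a; apply/funext => b; apply/funext => c; apply: sum_mulC. Qed.
Lemma act13C M N T : act1 M (act3 N T) = act3 N (act1 M T).
Proof. by apply/funext => a; apply/funext => b; apply/funext => c; apply: sum_mulC. Qed.
Lemma act23C M N T : act2 M (act3 N T) = act3 N (act2 M T).
Proof. by apply/funext => a; apply/funext => b; apply/funext => c; apply: sum_mulC. Qed.

Lemma sum_mul6 M N f a :
  \sum_x M a x * (\sum_y N x y * f y) = \sum_y mul6 M N a y * f y.
Proof.
under eq_bigr do rewrite mulr_sumr; rewrite exchange_big; apply: eq_bigr => y _ /=.
by rewrite mulr_suml; apply: eq_bigr => x _; rewrite mulrA.
Qed.

Lemma act1_mul M N T : act1 M (act1 N T) = act1 (mul6 M N) T.
Proof. by apply/funext => a; apply/funext => b; apply/funext => c; apply: sum_mul6. Qed.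
Lemma act2_mul M N T : act2 M (act2 N T) = act2 (mul6 M N) T.
Proof. by apply/funext => a; apply/funext => b; apply/funext => c; apply: sum_mul6. Qed.
Lemma act3_mul M N T : act3 M (act3 N T) = act3 (mul6 M N) T.
Proof. by apply/funext => a; apply/funext => b; apply/funext => c; apply: sum_mul6. Qed.

Lemma cube_mul M N T : cube (mul6 M N) T = cube M (cube N T).
Proof.
rewrite /cube -act1_mul -act2_mul -act3_mul.
by rewrite -(act13C N M) -(act12C N M) -(act23C N M).
Qed.

Lemma cube_one T : cube one6 T = T.
Proof.
have s1 f a : \sum_x one6 a x * f x = f a.
  rewrite (bigD1 a) //= /one6 eqxx mul1r big1 ?addr0 // => x.
  by rewrite eq_sym => /negPf ->; rewrite mul0r.
by apply/funext => a; apply/funext => b; apply/funext => c;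
  rewrite /cube /act1 !s1 /act2 !s1 /act3 !s1.
Qed.

(** Equivariance of the Lie algebra action [der] under the group action [cube]. The intertwining
    hypothesis replaces N' = M N M^-1 and avoids inverses. *)
Lemma cube_der M N N' T : mul6 N' M = mul6 M N ->
  der N' (cube M T) = cube M (der N T).
Proof.
move=> e; transitivity (fun a b c => cube M (act1 N T) a b c +
    cube M (act2 N T) a b c + cube M (act3 N T) a b c).
  apply/funext => a; apply/funext => b; apply/funext => c; rewrite /der;
    congr (_ + _ + _).
  - by rewrite /cube act1_mul e -act1_mul act12C act13C.
  - by rewrite {1}/cube -act12C act2_mul e -act2_mul -!/(cube _ _) act23C.
  - by rewrite {1}/cube -act13C -act23C act3_mul e -act3_mul.
apply/funext => a; apply/funext => b; apply/funext => c.
rewrite /cube /act1 -!big_split; apply: eq_bigr => x _ /=; rewrite -!mulrDr;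
  congr (_ * _).
rewrite /act2 -!big_split; apply: eq_bigr => y _ /=; rewrite -!mulrDr; congr (_ * _).
by rewrite /act3 -!big_split; apply: eq_bigr => z _ /=; rewrite -!mulrDr.
Qed.

Definition alternating T :=
  (forall a b c, T b a c = - T a b c) /\ (forall a b c, T a c b = - T a b c).
Definition primitive T :=
  alternating T /\ forall c, \sum_b sgn b * T b (star b) c = 0.

Lemma der_alternating M T : alternating T -> alternating (der M T).
Proof.
move=> [t12 t23]; have t13 a b c : T c b a = - T a b c by rewrite t12 t23 t12 opprK.
have s (u f g : idx -> K) : (forall x, f x = - g x) ->
    \sum_x u x * f x = - \sum_x u x * g x.
  by move=> e; rewrite -sumrN; apply: eq_bigr => x _; rewrite e mulrN.
split=> a b c; rewrite /der /act1 /act2 /act3.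
  rewrite (s (M b) (fun x => T x a c) (fun x => T a x c)) //.
  rewrite (s (M a) (fun x => T b x c) (fun x => T x b c)) //.
  by rewrite (s (M c) (fun x => T b a x) (fun x => T a b x)) //; ring.
rewrite (s (M a) (fun x => T x c b) (fun x => T x b c)) //.
rewrite (s (M c) (fun x => T a x b) (fun x => T a b x)) //.
by rewrite (s (M b) (fun x => T a c x) (fun x => T a x c)) //; ring.
Qed.

Lemma cube_primitive M T : sympl M -> primitive T -> primitive (cube M T).
Proof.
move=> sM [[t12 t23] t0]; split; [split|].
- move=> a b c; rewrite /cube /act1 /act2 sum_mulC -sumrN; apply: eq_bigr => x _.
  rewrite -mulrN -sumrN; congr (_ * _); apply: eq_bigr => y _; rewrite -mulrN.
  by congr (_ * _); rewrite /act3 -sumrN; apply: eq_bigr => z _; rewrite t12 mulrN.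
- move=> a b c; rewrite /cube /act1 -sumrN; apply: eq_bigr => x _.
  rewrite -mulrN; congr (_ * _); rewrite /act2 /act3 sum_mulC -sumrN.
  apply: eq_bigr => y _; rewrite -mulrN; congr (_ * _); rewrite -sumrN.
  by apply: eq_bigr => z _; rewrite t23 mulrN.
(* With the third slot outermost, the contraction only meets [act1 M (act2 M T)], where M^T J M = J
   turns it back into the contraction of T. *)
- move=> c; have := t0; have -> : cube M T = act3 M (act1 M (act2 M T)).
    by rewrite /cube act23C act13C.
  move=> h; transitivity (\sum_z M c z * (\sum_b sgn b * act1 M (act2 M T) b
    (star b) z)).
    rewrite /act3; under eq_bigr do rewrite mulr_sumr.
    rewrite exchange_big; apply: eq_bigr => z _; rewrite mulr_sumr.
    by apply: eq_bigr => b _; ring.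
  rewrite big1 // => z _; rewrite [X in _ * X](_ : _ = 0) ?mulr0 //.
  transitivity (\sum_b \sum_x \sum_y sgn b * M b x * M (star b) y * T x y z).
    apply: eq_bigr => b _; rewrite mulr_sumr; apply: eq_bigr => x _.
    by rewrite /act2 !mulr_sumr; apply: eq_bigr => y _; ring.
  rewrite exchange_big /= -[RHS](t0 z); apply: eq_bigr => x _.
  rewrite exchange_big (bigD1 (star x)) //= -mulr_suml sM eqxx big1 ?addr0 //.
  by move=> y /negPf n; rewrite -mulr_suml sM n mul0r.
Qed.

(* Symmetrised in T and U, this is the polarised moment map with values in
   S^2 V = sp(V). *)
Definition contr T U : idx -> idx -> K := fun a d =>
  \sum_b sgn b * \sum_c sgn c * (T a b c * U d (star b) (star c)).

(** Two slots of T are paired with two slots of U through J, and M cancels from each pair by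
    invariance of J; only the free slots a and d still carry M. *)
Lemma contr_cube M T U a d : sympl M ->
  contr (cube M T) (cube M U) a d = \sum_x \sum_y M a x * M d y * contr T U x y.
Proof.
move=> sM; transitivity (contr (act1 M T) (act1 M U) a d); last first.
  transitivity (\sum_x \sum_y \sum_b \sum_c sgn b * sgn c * (M a x * T x b c * (M
    d y * U y (star b) (star c)))).
    rewrite /contr; under eq_bigr => b _.
      rewrite mulr_sumr; under eq_bigr => c _.
        rewrite /act1 mulr_suml mulr_sumr mulr_sumr.
        under eq_bigr do rewrite !mulr_sumr.
        over.
      rewrite exchange_big; over.
    rewrite exchange_big; apply: eq_bigr => x _ /=.
    under eq_bigr do rewrite exchange_big.
    rewrite exchange_big; apply: eq_bigr => y _ /=.
    by apply: eq_bigr => b _; apply: eq_bigr => c _; rewrite !mulrA.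
  apply: eq_bigr => x _; apply: eq_bigr => y _; rewrite mulr_sumr.
  by apply: eq_bigr => b _; rewrite !mulr_sumr; apply: eq_bigr => c _; ring.
(* The contracted slots are treated one at a time: each is made the innermost sum and the outermost
   action before [sympl_pairing] removes M from it. *)
transitivity (\sum_c sgn c * \sum_b sgn b * (cube M T a b c * cube M U d (star b)
  (star c))).
  rewrite /contr; apply: sum_mulC.
transitivity (\sum_c sgn c * \sum_b sgn b * (act1 M (act3 M T) a b c * act1 M
  (act3 M U) d (star b) (star c))).
  apply: eq_bigr => c _; congr (_ * _); rewrite /cube !act12C.
  exact: (sympl_pairing (fun b => act1 M (act3 M T) a b c) (fun b => act1 M (act3
    M U) d b (star c)) sM).
rewrite sum_mulC; apply: eq_bigr => b _; congr (_ * _); rewrite !act13C.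
exact: (sympl_pairing (fun c => act1 M T a b c) (fun c => act1 M U d (star b) c) sM).
Qed.

(* The matrix S J, which lies in sp(V) when S is symmetric. *)
Definition ham (S : idx -> idx -> K) : idx -> idx -> K :=
  fun a b => - (sgn b * S a (star b)).

(** In matrix form, (M S M^T) J M = M S (M^T J M) = M S J. This is the intertwining hypothesis of
    [cube_der]. *)
Lemma ham_conj M S S' : sympl M ->
  (forall a d, S' a d = \sum_x \sum_y M a x * M d y * S x y) ->
  mul6 (ham S') M = mul6 M (ham S).
Proof.
move=> sM eS; apply/funext => a; apply/funext => c; rewrite /mul6 /ham.
have h : involutive star by exact: starK.
transitivity (\sum_x M a x * \sum_y S x y * (\sum_b sgn b * M b y * M (star b) c)).
  transitivity (\sum_b \sum_x \sum_y M a x * (S x y * (sgn b * M b y * M (star b) c))).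
    rewrite (reindex_inj (inv_inj h)); apply: eq_bigr => b _ /=.
    rewrite sgn_star starK (_ : - (- sgn b * S' a b) * _ = S' a b * (sgn b * M
      (star b) c)); last by ring.
    rewrite eS mulr_suml; apply: eq_bigr => x _.
    by rewrite mulr_suml; apply: eq_bigr => y _; ring.
  rewrite exchange_big; apply: eq_bigr => x _; rewrite exchange_big mulr_sumr /=.
  by apply: eq_bigr => y _; rewrite !mulr_sumr.
apply: eq_bigr => x _; congr (_ * _); under eq_bigr do rewrite sM.
rewrite (bigD1 (star c)) //= starK eqxx big1 ?addr0; first by rewrite sgn_star; ring.
move=> y /eqP ny; case: eqP => [e|_]; last by rewrite mulr0.
by case: ny; rewrite e starK.
Qed.

End Tensors.

(** * The Freudenthal space as primitive tensors *)

Local Notation o0 := (@Ordinal 3 0 isT).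
Local Notation o1 := (@Ordinal 3 1 isT).
Local Notation o2 := (@Ordinal 3 2 isT).

(** Normalises entries of a symmetric matrix to the upper triangle, so that [ring] and [field] see
    equal entries as the same atom. *)
Local Ltac upper s := rewrite ?(s o1 o0) ?(s o2 o0) ?(s o2 o1).

(** Case analysis that also normalises the bound proof to [isT], so that equalities of indices and
    the matches in [eps] and [skew3] compute. *)
Lemma I3_ind (P : 'I_3 -> Prop) : P o0 -> P o1 -> P o2 -> forall i, P i.
Proof. by move=> p0 p1 p2 [[|[|[|//]]] h]; rewrite (bool_irrelevance h isT). Qed.

Lemma sum3 (V : nmodType) (F : 'I_3 -> V) : \sum_i F i = F o0 + F o1 + F o2.
Proof.
rewrite !big_ord_recl big_ord0 addr0 addrA; congr (F _ + F _ + F _); exact: val_inj.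
Qed.

Lemma sum6 (V : nmodType) (F : idx -> V) : \sum_a F a =
  F (o0, true) + F (o0, false) + (F (o1, true) + F (o1, false)) +
  (F (o2, true) + F (o2, false)).
Proof.
rewrite (eq_bigr (fun p => F (p.1, p.2))) => [|[]//].
rewrite -(pair_big xpredT xpredT (fun i s => F (i, s))) /= sum3.
by rewrite !big_bool.
Qed.

Section Embedding.
Variable K : numFieldType.
Local Notation J := (jordan K).
Local Notation P := (freudenthal K).

Definition eps (i j k : nat) : K :=
  match i, j, k with
  | 0, 1, 2 | 1, 2, 0 | 2, 0, 1 => 1
  | 0, 2, 1 | 2, 1, 0 | 1, 0, 2 => -1
  | _, _, _ => 0
  end.

(** The entry is the sum over l of v_l eps_(ljk): the usual identification of vectors with
    skew-symmetric matrices in dimension three. *)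
Definition skew3 (v : 'I_3 -> K) (j k : nat) : K :=
  match j, k with
  | 1, 2 => v o0 | 2, 1 => - v o0
  | 2, 0 => v o1 | 0, 2 => - v o1
  | 0, 1 => v o2 | 1, 0 => - v o2
  | _, _ => 0
  end.

(* The 3 x 3 minors of a 6 x 3 matrix with blocks [Z; 1] are, up to sign, the
   entries of (Z, Z x Z, det Z, 1); this is the resulting identification of P
   with the primitive part of the third exterior power. *)
Definition embf (x y : 'I_3 -> 'I_3 -> K) (xi eta : K) (a b c : idx) : K :=
  let: (i, s) := a in let: (j, t) := b in let: (k, u) := c in
  match s, t, u with
  | false, false, false => xi * eps i j k
  | true, true, true => eta * eps i j k
  | false, true, true => skew3 (x i) j k
  | true, false, true => skew3 (x j) k i
  | true, true, false => skew3 (x k) i j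
  | true, false, false => skew3 (y i) j k
  | false, true, false => skew3 (y j) k i
  | false, false, true => skew3 (y k) i j
  end.

Definition emb (p : P) : idx -> idx -> idx -> K :=
  let: (X, Y, xi, eta) := p in embf (vsval X) (vsval Y) xi eta.

Lemma jsymE (X : J) i j : vsval X i j = vsval X j i.
Proof. by rewrite -[in LHS]jordan_sym mxE. Qed.

Definition sym3 (x : 'I_3 -> 'I_3 -> K) := forall i j, x i j = x j i.

Fact symJ_proof (x : 'I_3 -> 'I_3 -> K) :
  (\matrix_(i < 3, j < 3) if (i <= j)%N then x i j else x j i)^T =
  \matrix_(i < 3, j < 3) if (i <= j)%N then x i j else x j i.
Proof.
by apply/matrixP => i j; rewrite !mxE; case: ltngtP => // /val_inj ->.
Qed.

(** The upper triangle is reflected, so every function yields an element of the Jordan algebra;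
    symmetry only has to be checked where entries are read back. *)
Definition symJ x : J := Sym (symJ_proof x).

Lemma symJE x i j : sym3 x -> vsval (symJ x) i j = x i j.
Proof. by move=> sx; rewrite mxE; case: leqP. Qed.

Lemma jordanP (X Y : J) : (forall i j, vsval X i j = vsval Y i j) -> X = Y.
Proof. by move=> e; apply/val_inj/matrixP. Qed.

(* proj reads the coordinates off one representative of each orbit of slots. *)
Definition proj (T : idx -> idx -> idx -> K) : P :=
  (symJ (fun i l => T (i, false) (ordS l, true) (ordS (ordS l), true)),
   symJ (fun i l => T (i, true) (ordS l, false) (ordS (ordS l), false)),
   T (o0, false) (o1, false) (o2, false), T (o0, true) (o1, true) (o2, true)).

Lemma ordSE : (ordS o0 = o1) * (ordS o1 = o2) * (ordS o2 = o0).
Proof. by do !split; apply: val_inj. Qed.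

Lemma embK : cancel emb proj.
Proof.
move=> [[[X Y] xi] eta]; congr (_, _, _, _); try exact: mulr1.
- apply: jordanP => i j.
  rewrite symJE => [|{}i {}j].
    by elim/I3_ind: j; rewrite !ordSE.
  by elim/I3_ind: i; elim/I3_ind: j;
    rewrite !ordSE /= ?(jsymE _ o1 o0) ?(jsymE _ o2 o0) ?(jsymE _ o2 o1); ring.
- apply: jordanP => i j.
  rewrite symJE => [|{}i {}j].
    by elim/I3_ind: j; rewrite !ordSE.
  by elim/I3_ind: i; elim/I3_ind: j;
    rewrite !ordSE /= ?(jsymE _ o1 o0) ?(jsymE _ o2 o0) ?(jsymE _ o2 o1); ring.
Qed.

(** The 9 + 9 + 2 components compared here represent the 20 three-element subsets of the six
    indices. *)
Lemma alternating_eq (T U : idx -> idx -> idx -> K) : alternating T -> alternating U ->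
  (forall i l, T (i, false) (ordS l, true) (ordS (ordS l), true) = 
               U (i, false) (ordS l, true) (ordS (ordS l), true)) -> 
  (forall i l, T (i, true) (ordS l, false) (ordS (ordS l), false) = 
               U (i, true) (ordS l, false) (ordS (ordS l), false)) -> 
  (forall s, T (o0, s) (o1, s) (o2, s) = U (o0, s) (o1, s) (o2, s)) -> T = U.
Proof.
move=> [t12 t23] [u12 u23] e1 e2 e3.
have t13 a b c : T c b a = - T a b c by rewrite t12 t23 t12 opprK.
have u13 a b c : U c b a = - U a b c by rewrite u12 u23 u12 opprK.
have diag x : x = - x -> x = 0 :> K.
  by move=> /eqP; rewrite -subr_eq0 opprK -mulr2n mulrn_eq0 => /eqP.
have ta a b : T a b b = 0 by apply: diag; rewrite {1}t23.
have ua a b : U a b b = 0 by apply: diag; rewrite {1}u23.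
have tb a b : T a a b = 0 by apply: diag; rewrite {1}t12.
have ub a b : U a a b = 0 by apply: diag; rewrite {1}u12.
have tc a b : T a b a = 0 by rewrite t12 ta oppr0.
have uc a b : U a b a = 0 by rewrite u12 ua oppr0.
have main s t : s != t -> forall i j k, T (i, s) (j, t) (k, t) = U (i, s) (j, t) (k, t).
  move=> st; have e i l : T (i, s) (ordS l, t) (ordS (ordS l), t) = U (i, s)
    (ordS l, t) (ordS (ordS l), t).
    by case: s t st => [] [].
  move=> i j k; have [[ea eb] ec] := (e i o0, e i o1, e i o2);
    rewrite !ordSE in ea eb ec.
  elim/I3_ind: j; elim/I3_ind: k; rewrite ?ta ?ua //; by rewrite t23 u23; congr (- _).
have main3 s i j k : T (i, s) (j, s) (k, s) = U (i, s) (j, s) (k, s).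
  have := e3 s; elim/I3_ind: i; elim/I3_ind: j; elim/I3_ind: k => e;
    rewrite ?ta ?ua ?tb ?ub ?tc ?uc //.
  - by rewrite t23 u23 e.
  - by rewrite t12 u12 e.
  - by rewrite t23 t12 u23 u12 e.
  - by rewrite t12 t23 u12 u23 e.
  - by rewrite t13 u13 e.
apply/funext => -[i s]; apply/funext => -[j t]; apply/funext => -[k u].
case: (eqVneq s t) => [<-{t}|st].
  by case: (eqVneq s u) => [<-|su]; rewrite // t13 u13 main // eq_sym.
case: (eqVneq t u) => [<-|tu]; first exact: main.
have -> : u = s by move: s t u st tu => [] [] [].
by rewrite t12 u12 main // eq_sym.
Qed.

Lemma emb_primitive p : primitive (emb p).
Proof.
case: p => [[[X Y] xi] eta]; split; first split.
- move=> [i s] [j t] [k u]; elim/I3_ind: i; elim/I3_ind: j; elim/I3_ind: k;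
    by move: s t u => [] [] []; rewrite /=; ring.
- move=> [i s] [j t] [k u]; elim/I3_ind: i; elim/I3_ind: j; elim/I3_ind: k;
    by move: s t u => [] [] []; rewrite /=; ring.
- move=> [k u]; elim/I3_ind: k; case: u.
  all: by rewrite sum6 /sgn /= ?(jsymE _ o1 o0) ?(jsymE _ o2 o0) ?(jsymE _ o2 o1); ring.
Qed.

(** The six trace conditions say exactly that the two 3 x 3 blocks of mixed components are
    symmetric, which cuts the dimension from 20 to 14. *)
Lemma projK T : primitive T -> emb (proj T) = T.
Proof.
move=> [aT t0]; have [t12 t23] := aT.
have t13 a b c : T c b a = - T a b c by rewrite t12 t23 t12 opprK.
have diag x : x = - x -> x = 0 :> K.
  by move=> /eqP; rewrite -subr_eq0 opprK -mulr2n mulrn_eq0 => /eqP.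
have ta a b : T a b b = 0 by apply: diag; rewrite {1}t23.
have tb a b : T a a b = 0 by apply: diag; rewrite {1}t12.
have tc a b : T a b a = 0 by rewrite t12 ta oppr0.
have symT s t : s != t ->
    sym3 (fun i l => T (i, s) (ordS l, t) (ordS (ordS l), t)).
  (* In the trace, the terms of b and of [star b] coincide by alternation, so it is twice this sum
     up to sign. *)
  move=> st; have h k : T (o0, s) (o0, t) (k, t) + T (o1, s) (o1, t) (k, t)
      + T (o2, s) (o2, t) (k, t) = 0.
    have := t0 (k, t); rewrite sum6 /sgn /= !(t12 (_, true) (_, false)) => e.
    apply: (mulfI (_ : 2%:R != 0 :> K)); first by rewrite pnatr_eq0.
    rewrite mulr0; move: s t st e => [] [] //= _ e.
      by rewrite -oppr0 -e; ring.
    by rewrite -e !(t12 (_, true) (_, false)); ring.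
  have := h o0; have := h o1; have := h o2; rewrite !ta !(add0r, addr0).
  move=> h2 h1 h0.
  have e01 : T (o0, s) (o2, t) (o0, t) = T (o1, s) (o1, t) (o2, t).
    by apply/eqP; rewrite -subr_eq0 -oppr_eq0 -h2 [T _ (o2, t) _]t23; apply/eqP; ring.
  have e02 : T (o0, s) (o0, t) (o1, t) = T (o2, s) (o1, t) (o2, t).
    by apply/eqP; rewrite -subr_eq0 -h1 [T _ _ (o2, t)]t23; apply/eqP; ring.
  have e12 : T (o1, s) (o0, t) (o1, t) = T (o2, s) (o2, t) (o0, t).
    by apply/eqP; rewrite -subr_eq0 -oppr_eq0 -h0 [T _ _ (o1, t)]t23; apply/eqP; ring.
  by move=> i l; elim/I3_ind: i; elim/I3_ind: l; rewrite ?ordSE //.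
apply: alternating_eq => //; first by have [] := emb_primitive (proj T).
- move=> i l; have s1 := @symT false true isT; elim/I3_ind: i; elim/I3_ind: l;
    by rewrite !ordSE /emb /proj /embf /= !symJE // !ordSE.
- move=> i l; have s1 := @symT true false isT; elim/I3_ind: i; elim/I3_ind: l;
    by rewrite !ordSE /emb /proj /embf /= !symJE // !ordSE.
- by case; rewrite /= mulr1.
Qed.

End Embedding.

(** * Matrix formulas for the Jordan operations and the action of sp(6) in coordinates *)

Section CrossProduct.
Variable K : numFieldType.
Local Notation J := (jordan K).
Local Notation P := (freudenthal K).
Implicit Types (X Y Z W : J) (x y z w : 'I_3 -> 'I_3 -> K).

(** The polarised cofactor matrix; with cyclic indices the cofactors carry no signs. *)
Definition crs x y i j : K := 2^-1 *
  (x (ordS i) (ordS j) * y (ordS (ordS i)) (ordS (ordS j)) +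
   x (ordS (ordS i)) (ordS (ordS j)) * y (ordS i) (ordS j) -
   x (ordS i) (ordS (ordS j)) * y (ordS (ordS i)) (ordS j) -
   x (ordS (ordS i)) (ordS j) * y (ordS i) (ordS (ordS j))).

Definition dot x y : K := \sum_i \sum_j x i j * y i j.

Definition mul3 x y i j : K := \sum_k x i k * y k j.

Definition tr3 x : K := \sum_i x i i.

Lemma jmulE X Y i j : vsval (jmul X Y) i j =
  2^-1 * (mul3 (vsval X) (vsval Y) i j + mul3 (vsval Y) (vsval X) i j).
Proof. by rewrite /= !mxE. Qed.

Lemma jinner_dot X Y : jinner X Y = dot (vsval X) (vsval Y).
Proof. exact: jinnerE. Qed.

(** Polarisation of the Cayley-Hamilton formula for the adjugate, X^2 - tr(X) X + (1/2)(tr(X)^2 -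
    tr(X^2)) E. *)
Lemma jcrossE X Y i j : vsval (jcross X Y) i j = crs (vsval X) (vsval Y) i j.
Proof.
rewrite /jcross jinner_dot.
have -> : vsval (2^-1 *: (2 *: jmul X Y - jtr X *: Y - jtr Y *: X +
     (jtr X * jtr Y - dot (vsval X) (vsval Y)) *: jone K)) i j =
   2^-1 * (2 * vsval (jmul X Y) i j - tr3 (vsval X) * vsval Y i j -
     tr3 (vsval Y) * vsval X i j +
     (tr3 (vsval X) * tr3 (vsval Y) - dot (vsval X) (vsval Y)) * (i == j)%:R).
  by rewrite !mxE.
rewrite jmulE /crs /dot /mul3 /tr3 !sum3.
by elim/I3_ind: i; elim/I3_ind: j; rewrite !ordSE /=; upper (jsymE X);
  upper (jsymE Y); field.
Qed.

Lemma jinner_tr X Y : jinner X Y = \tr (vsval X *m vsval Y).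
Proof.
rewrite jinnerE; apply: eq_bigr => i _; rewrite mxE; apply: eq_bigr => j _.
by rewrite [vsval Y i j]jsymE.
Qed.

(** The commutator and the Jordan product add up to the triple product. So up to a scalar, X v W is
    the action Z |-> G Z + Z G^T of the matrix G = XW / 2, which is how it enters sp(6). *)
Lemma vee_mx X W Z : vsval (vee X W Z) =
  2^-1 *: (vsval X *m vsval W *m vsval Z + vsval Z *m vsval W *m vsval X) -
  (3^-1 * jinner X W) *: vsval Z.
Proof.
rewrite /vee !(add_lfunE, opp_lfunE, comp_lfunE, lfunE) /=.
rewrite !(mulmxDl, mulmxDr, scalerDr, mulmxBl, mulmxBr, =^~ scalemxAl, =^~
  scalemxAr, mulmxA, mulmx1, mul1mx, mulmxN, mulNmx).
(* After expansion only the six orderings of X, W, Z occur, and the identity is linear in them. *)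
move: (_ *m _ *m _) (_ *m _ *m _) (_ *m _ *m _) (_ *m _ *m _) (_ *m _ *m _) (_ *m
  _ *m _) => A1 A2 A3 A4 A5 A6.
by apply/matrixP => i j; rewrite !mxE; field.
Qed.

Lemma vee_adjoint X W Z Y : jinner (vee X W Z) Y = jinner Z (vee W X Y).
Proof.
rewrite !jinner_tr !vee_mx [in RHS]jinnerC.
rewrite mulmxBl mulmxBr -!scalemxAl -!scalemxAr !linearB /= !linearZ /=.
rewrite mulmxDl mulmxDr !linearD /= !mulmxA; congr (_ * _ + _).
rewrite addrC; congr (_ + _).
by rewrite -[X in \tr X = _]mulmxA mxtrace_mulC mulmxA.
Qed.

Lemma jinner_junit i j X : jinner (junit K i j) X = vsval X i j.
Proof.
have d a b : \tr (delta_mx a b *m vsval X) = vsval X b a.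
  rewrite /mxtrace (bigD1 a) //= mxE (bigD1 b) //= !mxE !eqxx mul1r.
  rewrite !big1 ?addr0 // => k /negPf n; last by rewrite mxE n andbF mul0r.
  by rewrite mxE big1 // => l _; rewrite mxE n mul0r.
rewrite jinner_tr /= -scalemxAl mulmxDl linearZ /= linearD /= !d.
by rewrite [vsval X j i]jsymE; field.
Qed.

Lemma jtranspose_eq (phi : 'End(J)) Y Z :
  (forall U, jinner (phi U) Y = jinner U Z) -> jtranspose phi Y = Z.
Proof.
move=> h; apply: jordanP => i j.
by rewrite -!jinner_junit -jtransposeP h.
Qed.

(** For symmetric A and B this is an element of S^2 V; with the [false] indices first, [ham] turns
    it into the matrix [-G, A; B, G^T] of sp(6). *)
Definition lie_block (A B G : 'I_3 -> 'I_3 -> K) (a b : idx) : K :=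
  let: (i, s) := a in let: (j, t) := b in
  match s, t with
  | false, false => A i j
  | false, true => G i j
  | true, false => G j i
  | true, true => - B i j
  end.

Lemma sym3_crs x y : sym3 x -> sym3 y -> sym3 (crs x y).
Proof.
move=> sx sy i j; rewrite /crs.
have e z : sym3 z -> (z (ordS i) (ordS j) = z (ordS j) (ordS i)) *
    (z (ordS i) (ordS (ordS j)) = z (ordS (ordS j)) (ordS i)) *
    (z (ordS (ordS i)) (ordS j) = z (ordS j) (ordS (ordS i))) *
    (z (ordS (ordS i)) (ordS (ordS j)) = z (ordS (ordS j)) (ordS (ordS i))).
  by move=> sz; do !split; apply: sz.
by rewrite !(e x) // !(e y) //; ring.
Qed.

Lemma embf_alternating x y xi eta : sym3 x -> sym3 y ->
  alternating (embf x y xi eta).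
Proof.
move=> sx sy; have [h _] := emb_primitive ((symJ x, symJ y, xi, eta) : P).
have -> // : embf x y xi eta = emb ((symJ x, symJ y, xi, eta) : P).
rewrite /emb; congr embf; apply/funext => i; apply/funext => j; by rewrite symJE.
Qed.

Definition lieX A B G x y (eta : K) i j : K :=
  tr3 G * x i j - mul3 G x i j - mul3 G x j i + 2 * crs B y i j + eta * A i j.
Definition lieY A B G x y (xi : K) i j : K :=
  2 * crs A x i j + (\sum_k G k i * y k j) + (\sum_k G k j * y k i)
  - tr3 G * y i j + xi * B i j.

(** The result has the form of Phi(phi, A, B, nu) with nu = - tr G and with phi the action X |-> -
    G0 X - X G0^T of the traceless part G0 of G. *)
Lemma der_embf A B G x y xi eta : sym3 A -> sym3 B -> sym3 x -> sym3 y ->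
  der (ham (lie_block A B G)) (embf x y xi eta) =
  embf (lieX A B G x y eta) (lieY A B G x y xi)
    (dot A y - tr3 G * xi) (dot B x + tr3 G * eta).
Proof.
move=> sA sB sx sy; apply: alternating_eq.
- exact/der_alternating/embf_alternating.
- apply: embf_alternating => i j; rewrite /lieX /lieY.
    by rewrite [crs _ _ j i]sym3_crs // [x j i]sx [A j i]sA; ring.
  by rewrite [crs _ _ j i]sym3_crs // [y j i]sy [B j i]sB; ring.
- move=> i l; elim/I3_ind: i; elim/I3_ind: l;
    rewrite !ordSE /der /act1 /act2 /act3 !sum6 /ham /star /sgn /=
      /lieX /tr3 /mul3 /crs !ordSE !sum3; upper sA; upper sB; upper sx; upper sy;
    by field.
- move=> i l; elim/I3_ind: i; elim/I3_ind: l;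
    rewrite !ordSE /der /act1 /act2 /act3 !sum6 /ham /star /sgn /=
      /lieY /tr3 /mul3 /crs !ordSE !sum3; upper sA; upper sB; upper sx; upper sy;
    by field.
- case; rewrite /der /act1 /act2 /act3 !sum6 /ham /star /sgn /=
    /dot /tr3 !sum3; upper sA; upper sB; upper sx; upper sy; by field.
Qed.

End CrossProduct.

(** * The cross product as a symmetrised contraction *)

Section CrossTensor.
Variable K : numFieldType.
Local Notation J := (jordan K).
Local Notation P := (freudenthal K).
Implicit Types (X Y Z W : J) (x y z w : 'I_3 -> 'I_3 -> K).

Definition crossA (p q : P) : J :=
  let: (X, Y, xi, _) := p in let: (Z, W, zeta, _) := q in
  - 4^-1 *: (2 *: jcross Y W - xi *: Z - zeta *: X).
Definition crossB (p q : P) : J :=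
  let: (X, Y, _, eta) := p in let: (Z, W, _, om) := q in
  4^-1 *: (2 *: jcross X Z - eta *: W - om *: Y).
(** The element of gl(3) encoding both phi and nu of P x Q: its traceless part gives phi, and the
    scalar term is chosen to make its trace equal to - nu. *)
Definition crossG (p q : P) (i j : 'I_3) : K :=
  let: (X, Y, xi, eta) := p in let: (Z, W, zeta, om) := q in
  4^-1 * (mul3 (vsval X) (vsval W) i j + mul3 (vsval Z) (vsval Y) i j) +
  (i == j)%:R *
  (8^-1 * (xi * om + zeta * eta - (dot (vsval X) (vsval W) + dot (vsval Z) (vsval Y)))).

Definition cross_block p q := lie_block (vsval (crossA p q)) (vsval (crossB p q))
  (crossG p q).

Lemma contr_emb (p q : P) a d :
  contr (emb p) (emb q) a d + contr (emb q) (emb p) a d = 16 * cross_block p q a d.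
Proof.
case: p => [[[X Y] xi] eta]; case: q => [[[Z W] zeta] om].
rewrite /cross_block /crossA /crossB /crossG /emb.
set A := vsval (- 4^-1 *: _); set B := vsval (4^-1 *: _).
have eA i j : A i j = - 4^-1 * (2 * crs (vsval Y) (vsval W) i j - xi * vsval Z i
  j - zeta * vsval X i j).
  by rewrite -jcrossE /A !mxE.
have eB i j : B i j = 4^-1 * (2 * crs (vsval X) (vsval Z) i j - eta * vsval W i j
  - om * vsval Y i j).
  by rewrite -jcrossE /B !mxE.
(* The Jordan elements are replaced by arbitrary symmetric functions, leaving a polynomial identity
   in their entries for each block. *)
move: A B eA eB; move: (jsymE X) (jsymE Y) (jsymE Z) (jsymE W).
move: (vsval X) (vsval Y) (vsval Z) (vsval W) => x y z w sx sy sz sw A B eA eB.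
case: a => [i s]; case: d => [j t].
move: s t => [] [].
- rewrite [RHS]/= eB /contr !sum6 /star /sgn /= /crs.
  by elim/I3_ind: i; elim/I3_ind: j; rewrite !ordSE /=; upper sx; upper sy;
    upper sz; upper sw; field.
- rewrite /contr !sum6 /star /sgn /= /mul3 /dot.
  by elim/I3_ind: i; elim/I3_ind: j; rewrite !sum3 /=; upper sx; upper sy;
    upper sz; upper sw; field.
- rewrite /contr !sum6 /star /sgn /= /mul3 /dot.
  by elim/I3_ind: i; elim/I3_ind: j; rewrite !sum3 /=; upper sx; upper sy;
    upper sz; upper sw; field.
- rewrite [RHS]/= eA /contr !sum6 /star /sgn /= /crs.
  by elim/I3_ind: i; elim/I3_ind: j; rewrite !ordSE /=; upper sx; upper sy;
    upper sz; upper sw; field.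
Qed.

Lemma veeE X W Z i j : vsval (vee X W Z) i j =
  2^-1 * (mul3 (mul3 (vsval X) (vsval W)) (vsval Z) i j +
          mul3 (mul3 (vsval Z) (vsval W)) (vsval X) i j) -
  3^-1 * dot (vsval X) (vsval W) * vsval Z i j.
Proof.
rewrite vee_mx -jinner_dot !mxE; congr (_ * (_ + _) - _).
  by apply: eq_bigr => k _; rewrite mxE.
by apply: eq_bigr => k _; rewrite mxE.
Qed.

Lemma mul3_tr x y i j : sym3 x -> sym3 y -> mul3 x y i j = mul3 y x j i.
Proof. by move=> sx sy; apply: eq_bigr => k _; rewrite sx sy mulrC. Qed.

Lemma mul3A x y z i j : mul3 (mul3 x y) z i j = mul3 x (mul3 y z) i j.
Proof.
rewrite /mul3; under eq_bigr do rewrite mulr_suml.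
rewrite exchange_big; apply: eq_bigr => l _ /=.
by rewrite mulr_sumr; apply: eq_bigr => k _; rewrite mulrA.
Qed.

Lemma mul3_rev x y z i j : sym3 x -> sym3 y -> sym3 z ->
  mul3 (mul3 x y) z i j = mul3 (mul3 z y) x j i.
Proof.
move=> sx sy sz; rewrite mul3A; apply: eq_bigr => k _.
by rewrite (mul3_tr _ _ sy sz) sx mulrC.
Qed.

Lemma mul3_shift m n (g : K) x i j :
  \sum_k (4^-1 * (m i k + n i k) + (i == k)%:R * g) * x k j =
  4^-1 * (mul3 m x i j + mul3 n x i j) + g * x i j.
Proof.
transitivity (\sum_k 4^-1 * (m i k * x k j + n i k * x k j) +
    \sum_k (i == k)%:R * (g * x k j)).
  by rewrite -big_split; apply: eq_bigr => k _ /=; ring.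
rewrite -mulr_sumr big_split; congr (_ + _).
rewrite (bigD1 i) //= eqxx mul1r big1 ?addr0 // => k.
by rewrite eq_sym => /negPf ->; rewrite mul0r.
Qed.

Lemma jentD X Y i j : vsval (X + Y) i j = vsval X i j + vsval Y i j.
Proof. exact: mxE. Qed.
Lemma jentN X i j : vsval (- X) i j = - vsval X i j.
Proof. exact: mxE. Qed.
Lemma jentZ (k : K) X i j : vsval (k *: X) i j = k * vsval X i j.
Proof. exact: mxE. Qed.
Definition jentE := (jentD, jentN, jentZ).

Lemma emb_pcross (p q r : P) :
  emb (pcross p q r) = der (ham (cross_block p q)) (emb r).
Proof.
case: p => [[[X Y] xi] eta]; case: q => [[[Z W] zeta] om]; case: r => [[[U V] a] b].
rewrite /cross_block [in RHS]/emb der_embf; try exact: jsymE.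
rewrite [pcross _ _ _]PhiE /Phi_fun -/(crossA (X, Y, xi, eta) (Z, W, zeta, om))
  -/(crossB (X, Y, xi, eta) (Z, W, zeta, om)).
(* The transpose of X v W is W v X, by cyclicity of the trace. *)
rewrite (@jtranspose_eq _ _ _ (- 2^-1 *: (vee W X V + vee Y Z V))); last first.
  move=> T; rewrite scale_lfunE add_lfunE [LHS]jinnerC.
  rewrite [LHS]linearZ [RHS]linearZ /=; congr (_ * _).
  rewrite [LHS]linearD [RHS]linearD /= ![jinner V _]jinnerC.
  by rewrite !vee_adjoint.
rewrite scale_lfunE add_lfunE !jinner_dot.
move: (crossA _ _) (crossB _ _) => A B; set G := crossG _ _.
have tG : tr3 G = 8^-1 * (3 * (xi * om + zeta * eta) - (dot (vsval X) (vsval W) +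
  dot (vsval Z) (vsval Y))).
  rewrite /tr3 /G /crossG /mul3 /dot !sum3 /=.
  by upper (jsymE X); upper (jsymE Y); upper (jsymE Z); upper (jsymE W); field.
pose g : K := 8^-1 * (xi * om + zeta * eta -
  (dot (vsval X) (vsval W) + dot (vsval Z) (vsval Y))).
rewrite /emb; congr embf.
- apply/funext => i; apply/funext => j; have := jcrossE B V i j.
  move: (jcross B V) => C; rewrite !jentE !veeE => ->.
  have mG a' b' : mul3 G (vsval U) a' b' = 4^-1 *
      (mul3 (mul3 (vsval X) (vsval W)) (vsval U) a' b' +
       mul3 (mul3 (vsval Z) (vsval Y)) (vsval U) a' b') + g * vsval U a' b'.
    exact: (mul3_shift (mul3 _ _) (mul3 _ _) g).
  rewrite /lieX tG !mG (mul3_rev i j (jsymE U) (jsymE W) (jsymE X)).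
  rewrite (mul3_rev i j (jsymE U) (jsymE Y) (jsymE Z)) (jsymE U j i).
  by rewrite /g; field.
- apply/funext => i; apply/funext => j; have := jcrossE A U i j.
  move: (jcross A U) => C; rewrite !jentE !veeE => ->.
  have mG a' b' : \sum_k G k a' * vsval V k b' = 4^-1 *
      (mul3 (mul3 (vsval W) (vsval X)) (vsval V) a' b' +
       mul3 (mul3 (vsval Y) (vsval Z)) (vsval V) a' b') + g * vsval V a' b'.
    rewrite -mul3_shift; apply: eq_bigr => k _; rewrite /G /crossG [k == _]eq_sym.
    by rewrite (mul3_tr _ _ (jsymE X) (jsymE W)) (mul3_tr _ _ (jsymE Z) (jsymE Y)).
  have dC x y : dot x y = dot y x.
    by apply: eq_bigr => ? _; apply: eq_bigr => ? _; rewrite mulrC.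
  rewrite /lieY tG !mG (mul3_rev i j (jsymE V) (jsymE X) (jsymE W)).
  rewrite (mul3_rev i j (jsymE V) (jsymE Z) (jsymE Y)) (jsymE V j i).
  by rewrite (dC (vsval W)) (dC (vsval Y) (vsval Z)) /g; field.
- by rewrite tG; field.
- by rewrite tG; field.
Qed.

End CrossTensor.

(** * The representation of the symplectic group *)

(* Kept opaque to unification, which would otherwise unfold the vector space
   structure of 'End(freudenthal K). *)
Definition lin_comb (K : fieldType) (V : vectType K) (I : finType)
  (c : I -> K) (v : I -> V) : V := \sum_i c i *: v i.

Lemma coord_lin_comb (K : fieldType) (V : vectType K) (I : finType)
    (c : I -> K) (v : I -> V) j :
  coord (vbasis {:V}) j (lin_comb c v) = \sum_i c i * coord (vbasis {:V}) j (v i).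
Proof. by rewrite /lin_comb linear_sum; apply: eq_bigr => i _; rewrite linearZ. Qed.

Lemma lin_comb_lfunE (K : fieldType) (U V : vectType K) (I : finType)
    (c : I -> K) (v : I -> 'Hom(U, V)) (x : U) :
  lin_comb c v x = \sum_i c i *: v i x.
Proof. by rewrite /lin_comb sum_lfunE; apply: eq_bigr => i _; rewrite scale_lfunE. Qed.

Section Representation.
Variable K : numFieldType.
Local Notation J := (jordan K).
Local Notation P := (freudenthal K).
Implicit Types (M N : idx -> idx -> K) (T U : idx -> idx -> idx -> K).
Implicit Types (p q r : P).

Lemma emb_linear k p q a b c : emb (k *: p + q) a b c = k * emb p a b c + emb q a b c.
Proof.
case: p => [[[X Y] xi] eta]; case: q => [[[Z W] zeta] om].
have sk V V' (i j l : 'I_3) : skew3 (vsval (k *: V + V' : J) i) j l =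
    k * skew3 (vsval V i) j l + skew3 (vsval V' i) j l.
  by elim/I3_ind: j; elim/I3_ind: l;
    rewrite /skew3 ?mulr0 ?addr0 ?jentD ?jentZ ?mulrN ?opprD.
case: a b c => [i s] [j t] [l u]; rewrite /emb /embf.
by move: s t u => [] [] [] /=; rewrite ?sk // mulrDl mulrA.
Qed.

Lemma emb_inj : injective (@emb K).
Proof. exact/can_inj/embK. Qed.

Lemma proj_linear k T U :
  proj (fun a b c => k * T a b c + U a b c) = k *: proj T + proj U.
Proof.
by congr (_, _, _, _); apply: jordanP => i j; rewrite jentD jentZ !mxE; case: ifP.
Qed.

Lemma proj0 : proj (fun _ _ _ => 0) = 0 :> P.
Proof. by congr (_, _, _, _); apply: jordanP => i j; rewrite !mxE; case: ifP. Qed.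

Lemma proj_sum (I : Type) (s : seq I) (f : I -> K) (g : I -> idx -> idx -> idx -> K) :
  proj (fun a b c => \sum_(t <- s) f t * g t a b c) = \sum_(t <- s) f t *: proj (g t).
Proof.
elim: s => [|t s IH].
  rewrite big_nil -[RHS]proj0; congr proj.
  by apply/funext => a; apply/funext => b; apply/funext => c; rewrite big_nil.
rewrite big_cons -IH -proj_linear; congr proj.
by apply/funext => a; apply/funext => b; apply/funext => c; rewrite big_cons.
Qed.

Local Notation idx3 := (idx * idx * idx)%type.

Definition delta3 (t : idx3) (a b c : idx) : K := ((a, b, c) == t)%:R.

Definition elem3_fun (t u : idx3) (p : P) : P :=
  emb p u.1.1 u.1.2 u.2 *: proj (delta3 t).

Lemma elem3_linear t u : linear (elem3_fun t u).
Proof. by move=> k p q; rewrite /elem3_fun emb_linear scalerDl scalerA. Qed.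
HB.instance Definition _ t u :=
  GRing.isLinear.Build K P P _ (elem3_fun t u) (elem3_linear t u).

Definition coef3 M (t u : idx3) : K := M t.1.1 u.1.1 * M t.1.2 u.1.2 * M t.2 u.2.

(** Written as a combination of fixed endomorphisms with cubic coefficients, so that its coordinates
    are visibly polynomial in the entries of an arbitrary M; [rhoE] gives the conceptual form. *)
Definition rho M : 'End(P) :=
  lin_comb (fun tu : idx3 * idx3 => coef3 M tu.1 tu.2)
           (fun tu => linfun (elem3_fun tu.1 tu.2)).

Lemma cubeE M T a b c :
  cube M T a b c = \sum_(u : idx3) coef3 M (a, b, c) u * T u.1.1 u.1.2 u.2.
Proof.
rewrite -(pair_big xpredT xpredT
  (fun x z => coef3 M (a, b, c) (x, z) * T x.1 x.2 z)) /=.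
rewrite -(pair_big xpredT xpredT
  (fun x y => \sum_z coef3 M (a, b, c) (x, y, z) * T x y z)) /=.
rewrite /cube /act1 /act2 /act3; apply: eq_bigr => x _.
rewrite mulr_sumr; apply: eq_bigr => y _; rewrite !mulr_sumr.
by apply: eq_bigr => z _; rewrite /coef3 /= !mulrA.
Qed.

Lemma rhoE M p : rho M p = proj (cube M (emb p)).
Proof.
transitivity (proj (fun a b c => \sum_(t : idx3) cube M (emb p) t.1.1 t.1.2 t.2 *
  delta3 t a b c)).
  rewrite proj_sum lin_comb_lfunE -(pair_big xpredT xpredT
    (fun t u => coef3 M t u *: linfun (elem3_fun t u) p)) /=.
  apply: eq_bigr => -[[a b] c] _; rewrite cubeE scaler_suml.
  by apply: eq_bigr => u _; rewrite lfunE /= scalerA.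
congr proj; apply/funext => a; apply/funext => b; apply/funext => c.
rewrite (bigD1 (a, b, c)) //= /delta3 eqxx mulr1 big1 ?addr0 // => t.
by rewrite eq_sym => /negPf ->; rewrite mulr0.
Qed.

Lemma emb_rho M p : sympl M -> emb (rho M p) = cube M (emb p).
Proof. by move=> sM; rewrite rhoE projK //; apply/cube_primitive/emb_primitive. Qed.

(** Only the inner factor must be symplectic: it has to produce a primitive tensor, on which [proj]
    loses nothing. *)
Lemma rho_mul M N : sympl N -> rho (mul6 M N) = (rho M \o rho N)%VF.
Proof.
move=> sN; apply/lfunP => p; rewrite comp_lfunE !rhoE cube_mul projK //.
exact/cube_primitive/emb_primitive.
Qed.

Lemma rho_one : rho (@one6 K) = \1%VF.
Proof. by apply/lfunP => p; rewrite rhoE cube_one embK id_lfunE. Qed.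

(** The symplectic adjoint J^-1 M^T J. *)
Definition inv6 M (a b : idx) : K := sgn K a * sgn K b * M (star b) (star a).

Lemma inv6_mul M : sympl M -> mul6 (inv6 M) M = @one6 K.
Proof.
move=> sM; apply/funext => a; apply/funext => c; rewrite /mul6 /inv6 /one6.
have h : involutive star by exact: starK.
rewrite (reindex_inj (inv_inj h)) /=.
transitivity (- sgn K a * \sum_b sgn K b * M b (star a) * M (star b) c).
  by rewrite mulr_sumr; apply: eq_bigr => b _; rewrite starK sgn_star; ring.
rewrite sM starK [c == a]eq_sym; case: eqP => _; last by rewrite mulr0.
by rewrite sgn_star mulrNN sgn_sqr.
Qed.

Lemma rho_inv M : sympl M -> (rho (inv6 M) \o rho M)%VF = \1%VF.
Proof. by move=> sM; rewrite -rho_mul // inv6_mul // rho_one. Qed.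

Lemma rho_ker M : sympl M -> lker (rho M) == 0%VS.
Proof.
move=> sM; apply/lker0P => p q /(congr1 (rho (inv6 M))).
by rewrite -!comp_lfunE rho_inv // !id_lfunE.
Qed.

Lemma cross_block_rho M p q a d : sympl M ->
  cross_block (rho M p) (rho M q) a d =
  \sum_x \sum_y M a x * M d y * cross_block p q x y.
Proof.
move=> sM; have c16 : 16%:R != 0 :> K by rewrite pnatr_eq0.
apply: (mulfI c16); rewrite -contr_emb !emb_rho // !contr_cube // mulr_sumr -big_split.
apply: eq_bigr => x _; rewrite mulr_sumr -big_split; apply: eq_bigr => y _ /=.
by rewrite mulrCA -contr_emb; ring.
Qed.

Lemma rho_pcross M p q r : sympl M ->
  rho M (pcross p q r) = pcross (rho M p) (rho M q) (rho M r).
Proof.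
move=> sM; apply: emb_inj; rewrite emb_rho // !emb_pcross emb_rho //.
apply/esym/cube_der/ham_conj => // a d; exact: cross_block_rho.
Qed.

Lemma rho_preserves M : sympl M -> preserves (@pcross K) (rho M).
Proof.
move=> sM; have kM := rho_ker sM; split=> // p q; apply/lfunP => r.
by rewrite !comp_lfunE rho_pcross // lker0_lfunVK.
Qed.

End Representation.

(** * Unipotent and block diagonal symplectic matrices *)

Section GroupElements.
Variable K : numFieldType.
Local Notation J := (jordan K).
Local Notation P := (freudenthal K).
Local Notation mat3 := ('I_3 -> 'I_3 -> K).
Implicit Types (M N : idx -> idx -> K) (T U : idx -> idx -> idx -> K).
Implicit Types (p q r : P) (X Y : J) (x y a b c d : mat3).

Definition e3 : P := (0, 0, 1, 0).
Definition e4 : P := (0, 0, 0, 1).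

Definition blocks a b c d (u v : idx) : K :=
  let: (i, s) := u in let: (j, t) := v in
  match s, t with
  | false, false => a i j | false, true => b i j
  | true, false => c i j | true, true => d i j
  end.

Definition id3 : mat3 := fun i j => (i == j)%:R.
Definition zero3 : mat3 := fun _ _ => 0.

Lemma sum_idx (V : nmodType) (F : idx -> V) :
  \sum_u F u = \sum_i F (i, false) + \sum_i F (i, true).
Proof.
rewrite (eq_bigr (fun u => F (u.1, u.2))) => [|[]//].
rewrite -(pair_big xpredT xpredT (fun i s => F (i, s))) /= -big_split.
by apply: eq_bigr => i _; rewrite big_bool /= addrC.
Qed.

Lemma sympl_blocks a b c d :
  (forall j k, \sum_i a i j * c i k = \sum_i a i k * c i j) ->
  (forall j k, \sum_i b i j * d i k = \sum_i b i k * d i j) ->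
  (forall j k, \sum_i (a i j * d i k - c i j * b i k) = (j == k)%:R) ->
  sympl (blocks a b c d).
Proof.
move=> ac bd ad [j s] [k t]; rewrite sum_idx -big_split /sgn /star /=.
move: s t => [] [] /=; rewrite xpair_eqE ?andbT ?andbF.
- under eq_bigr => i _ do rewrite mul1r mulN1r mulNr.
  by rewrite sumrB (bd j k); under eq_bigr do rewrite mulrC; rewrite subrr.
- under eq_bigr => i _ do rewrite mul1r mulN1r mulNr -opprB mulrC -[X in _ - X]mulrC.
  rewrite sumrN (eq_bigr (fun i => a i k * d i j - c i k * b i j));
    last by move=> i _; ring.
  by rewrite ad; case: eqP => _; rewrite ?oppr0.
- under eq_bigr => i _ do rewrite mul1r mulN1r mulNr.
  by rewrite ad eq_sym; case: eqP.
- under eq_bigr => i _ do rewrite mul1r mulN1r mulNr.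
  by rewrite sumrB (ac j k); under eq_bigr do rewrite mulrC; rewrite subrr.
Qed.

Definition uni_hi x := blocks id3 x zero3 id3.
Definition uni_lo y := blocks id3 zero3 y id3.
Definition levi a d := blocks a zero3 zero3 d.

Lemma sum_id3 (f : 'I_3 -> K) i : \sum_k id3 i k * f k = f i.
Proof.
rewrite (bigD1 i) //= /id3 eqxx mul1r big1 ?addr0 // => k.
by rewrite eq_sym => /negPf ->; rewrite mul0r.
Qed.

Lemma sum_id3r (f : 'I_3 -> K) i : \sum_k f k * id3 k i = f i.
Proof. by rewrite -[RHS]sum_id3; apply: eq_bigr => k _; rewrite mulrC /id3 eq_sym. Qed.

Lemma sum_id3l (f : 'I_3 -> K) i : \sum_k id3 k i * f k = f i.
Proof. by rewrite -[RHS]sum_id3r; apply: eq_bigr => k _; rewrite mulrC. Qed.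

Lemma uni_hi_sympl x : sym3 x -> sympl (uni_hi x).
Proof.
move=> sx; apply: sympl_blocks => j k.
- by apply: eq_bigr => i _; rewrite !mulr0.
- by rewrite !sum_id3r sx.
- by under eq_bigr do rewrite mul0r subr0; rewrite sum_id3l.
Qed.

Lemma uni_lo_sympl x : sym3 x -> sympl (uni_lo x).
Proof.
move=> sx; apply: sympl_blocks => j k.
- by rewrite !sum_id3l sx.
- by apply: eq_bigr => i _; rewrite !mul0r.
- by under eq_bigr do rewrite mulr0 subr0; rewrite sum_id3l.
Qed.

Lemma levi_sympl a d :
  (forall j k, \sum_i a i j * d i k = (j == k)%:R) -> sympl (levi a d).
Proof.
move=> h; apply: sympl_blocks => j k.
- by apply: eq_bigr => i _; rewrite !mulr0.
- by apply: eq_bigr => i _; rewrite !mul0r.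
- by under eq_bigr do rewrite mulr0 subr0; rewrite h.
Qed.

Lemma uni_loK y : mul6 (uni_lo (fun i j => - y i j)) (uni_lo y) = @one6 K.
Proof.
apply/funext => -[i s]; apply/funext => -[j t];
  rewrite /mul6 sum_idx /one6 xpair_eqE /=.
move: s t => [] [] /=; rewrite ?andbT ?andbF.
- by rewrite sum_id3 big1 ?add0r // => k _; rewrite mulr0.
- by rewrite sum_id3r sum_id3 addNr.
- by rewrite !big1 ?addr0 // => k _; rewrite (mulr0, mul0r).
- by rewrite sum_id3 big1 ?addr0 // => k _; rewrite mul0r.
Qed.

Definition det3 a : K :=
  a o0 o0 * (a o1 o1 * a o2 o2 - a o1 o2 * a o2 o1)
  - a o0 o1 * (a o1 o0 * a o2 o2 - a o1 o2 * a o2 o0)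
  + a o0 o2 * (a o1 o0 * a o2 o1 - a o1 o1 * a o2 o0).

Definition row3 (f g h : 'I_3 -> K) : mat3 :=
  fun i => match i : nat with 0 => f | 1 => g | _ => h end.

Lemma skew3_0 i (j k : nat) : skew3 (vsval (0 : J) i) j k = 0.
Proof. by rewrite /skew3; case: j k => [|[|[|?]]] [|[|[|?]]]; rewrite ?mxE ?oppr0. Qed.

Lemma emb_e3 : emb e3 =
  fun u v w => if u.2 || v.2 || w.2 then 0 else eps K u.1 v.1 w.1.
Proof.
apply/funext => -[i s]; apply/funext => -[j t]; apply/funext => -[k u].
by move: s t u => [] [] []; rewrite /= ?skew3_0 ?mul0r ?mul1r.
Qed.

Lemma emb_e4 : emb e4 =
  fun u v w => if [&& u.2, v.2 & w.2] then eps K u.1 v.1 w.1 else 0.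
Proof.
apply/funext => -[i s]; apply/funext => -[j t]; apply/funext => -[k u].
by move: s t u => [] [] []; rewrite /= ?skew3_0 ?mul0r ?mul1r.
Qed.

(** [e3] is the wedge of the three [false] basis vectors, so its image has the 3 x 3 minors of the
    corresponding columns of M as components. *)
Lemma cube_e3 M u v w : cube M (emb e3) u v w =
  det3 (row3 (fun i => M u (i, false)) (fun i => M v (i, false)) (fun i => M w
    (i, false))).
Proof.
by rewrite /cube /act1 /act2 /act3 emb_e3 !(sum_idx, sum3) /= /det3 /row3 /=; ring.
Qed.

Lemma cube_e4 M u v w : cube M (emb e4) u v w =
  det3 (row3 (fun i => M u (i, true)) (fun i => M v (i, true)) (fun i => M w (i,
    true))).
Proof.
by rewrite /cube /act1 /act2 /act3 emb_e4 !(sum_idx, sum3) /= /det3 /row3 /=; ring.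
Qed.

End GroupElements.

(** * Action of these matrices on e3, e4 and the first coordinate *)

Section GroupAction.
Variable K : numFieldType.
Local Notation J := (jordan K).
Local Notation P := (freudenthal K).
Local Notation mat3 := ('I_3 -> 'I_3 -> K).
Local Notation e3 := (e3 K).
Local Notation e4 := (e4 K).
Implicit Types (M N : idx -> idx -> K) (T U : idx -> idx -> idx -> K).
Implicit Types (p q r : P) (X Y : J) (x y a b c d : mat3).

Lemma symJ_eq x y : (forall i j : 'I_3, (i <= j)%N -> x i j = y i j) -> symJ x = symJ y.
Proof.
by move=> e; apply: jordanP => i j; rewrite !mxE; case: leqP => [|/ltnW] /e.
Qed.

Lemma rho_uni_hi_e4 x : sym3 x ->
  rho (uni_hi x) e4 = (symJ x, symJ (crs x x), det3 x, 1).
Proof.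
move=> sx; rewrite rhoE; congr (_, _, _, _).
- apply: symJ_eq => i j; rewrite cube_e4 /det3 /row3 /uni_hi /blocks /id3.
  by elim/I3_ind: i; elim/I3_ind: j => // _; rewrite !ordSE /=; ring.
- apply: symJ_eq => i j; rewrite cube_e4 /det3 /row3 /uni_hi /blocks /id3 /crs.
  by elim/I3_ind: i; elim/I3_ind: j => // _; rewrite !ordSE /=; upper sx; field.
- by rewrite cube_e4.
- by rewrite cube_e4 /det3 /row3 /= /id3 /=; ring.
Qed.

Lemma rho_uni_lo_e3 y : sym3 y ->
  rho (uni_lo y) e3 = (symJ (crs y y), symJ y, 1, det3 y).
Proof.
move=> sx; rewrite rhoE; congr (_, _, _, _).
- apply: symJ_eq => i j; rewrite cube_e3 /det3 /row3 /uni_lo /blocks /id3 /crs.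
  by elim/I3_ind: i; elim/I3_ind: j => // _; rewrite !ordSE /=; upper sx; field.
- apply: symJ_eq => i j; rewrite cube_e3 /det3 /row3 /uni_lo /blocks /id3.
  by elim/I3_ind: i; elim/I3_ind: j => // _; rewrite !ordSE /=; ring.
- by rewrite cube_e3 /det3 /row3 /= /id3 /=; ring.
- by rewrite cube_e3.
Qed.

Lemma symJ0 : symJ (fun _ _ => 0) = 0 :> J.
Proof. by apply: jordanP => i j; rewrite !mxE; case: ifP. Qed.

Lemma rho_uni_lo_e4 y : rho (uni_lo y) e4 = e4.
Proof.
rewrite rhoE; congr (_, _, _, _).
- rewrite -[RHS]symJ0; apply: symJ_eq => i j _.
  by rewrite cube_e4 /det3 /row3 /uni_lo /blocks /zero3 /=; ring.
- rewrite -[RHS]symJ0; apply: symJ_eq => i j _.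
  by rewrite cube_e4 /det3 /row3 /uni_lo /blocks /zero3 /=; ring.
- by rewrite cube_e4 /det3 /row3 /= /zero3; ring.
- by rewrite cube_e4 /det3 /row3 /= /id3 /=; ring.
Qed.

Lemma rho_levi_e4 a d : rho (levi a d) e4 = (0, 0, 0, det3 d).
Proof.
rewrite rhoE; congr (_, _, _, _).
- rewrite -[RHS]symJ0; apply: symJ_eq => i j _.
  by rewrite cube_e4 /det3 /row3 /levi /blocks /zero3 /=; ring.
- rewrite -[RHS]symJ0; apply: symJ_eq => i j _.
  by rewrite cube_e4 /det3 /row3 /levi /blocks /zero3 /=; ring.
- by rewrite cube_e4 /det3 /row3 /= /zero3; ring.
- by rewrite cube_e4.
Qed.

Lemma rho_levi_e3 a d : rho (levi a d) e3 = (0, 0, det3 a, 0).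
Proof.
rewrite rhoE; congr (_, _, _, _).
- rewrite -[RHS]symJ0; apply: symJ_eq => i j _.
  by rewrite cube_e3 /det3 /row3 /levi /blocks /zero3 /=; ring.
- rewrite -[RHS]symJ0; apply: symJ_eq => i j _.
  by rewrite cube_e3 /det3 /row3 /levi /blocks /zero3 /=; ring.
- by rewrite cube_e3.
- by rewrite cube_e3 /det3 /row3 /= /zero3; ring.
Qed.

(** A polynomial in y whose coefficients are all the coordinates of the vector; it serves to make
    the last coordinate nonzero. *)
Lemma rho_uni_lo_last y (X Y : J) (xi eta : K) : sym3 y ->
  (rho (uni_lo y) ((X, Y, xi, eta) : P)).2 =
  eta + dot y (vsval X) + dot (crs y y) (vsval Y) + xi * det3 y.
Proof.
move=> sy; have loE i (F : idx -> K) : \sum_u uni_lo y (i, true) u * F u =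
    \sum_k y i k * F (k, false) + F (i, true).
  by rewrite sum_idx /= (sum_id3 (fun k => F (k, true))).
rewrite rhoE /proj /cube /act1 /act2 /act3 /= !(loE, sum3) /=.
rewrite /dot /crs /det3 !sum3 !ordSE.
by upper (jsymE X); upper (jsymE Y); upper sy; field.
Qed.

Definition cof3 a i j : K :=
  a (ordS i) (ordS j) * a (ordS (ordS i)) (ordS (ordS j)) -
  a (ordS i) (ordS (ordS j)) * a (ordS (ordS i)) (ordS j).

Lemma cof3_mul a j k : \sum_i a i j * cof3 a i k = det3 a * (j == k)%:R.
Proof.
rewrite sum3 /cof3 /det3.
by elim/I3_ind: j; elim/I3_ind: k; rewrite !ordSE /=; ring.
Qed.

(** The first coordinate uses one [false] slot, where a acts, and two [true] slots, where the
    cofactor matrix acts. The cofactor matrix of the latter is det(a) a, whence det(a) a X a^T. *)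
Lemma rho_levi_X a (X Y : J) (xi eta : K) :
  (rho (levi a (cof3 a)) ((X, Y, xi, eta) : P)).1.1.1 =
  symJ (fun i j => det3 a * \sum_k \sum_l a i k * vsval X k l * a j l).
Proof.
have leE s i (F : idx -> K) : \sum_u levi a (cof3 a) (i, s) u * F u =
    \sum_k (if s then cof3 a else a) i k * F (k, s).
  rewrite sum_idx; case: s => /=.
    by rewrite big1 ?add0r // => k _; rewrite mul0r.
  by rewrite [X in _ + X]big1 ?addr0 // => k _; rewrite mul0r.
rewrite rhoE; apply: symJ_eq => i j; rewrite /cube /act1 /act2 /act3.
rewrite !(leE, sum3) /=; elim/I3_ind: i; elim/I3_ind: j => // _;
  by rewrite !ordSE /= /cof3 !ordSE /det3; upper (jsymE X); ring.
Qed.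

End GroupAction.

(** * Cross products involving e3 and e4 *)

Section SpecialProducts.
Variable K : numFieldType.
Local Notation J := (jordan K).
Local Notation P := (freudenthal K).
Local Notation mat3 := ('I_3 -> 'I_3 -> K).
Local Notation e3 := (e3 K).
Local Notation e4 := (e4 K).
Implicit Types (p q r : P) (X Y Z W U V : J).

Lemma symJK X : symJ (vsval X) = X.
Proof. by apply: jordanP => i j; rewrite symJE //; apply: jsymE. Qed.

Lemma symJ_jcross X Y : symJ (crs (vsval X) (vsval Y)) = jcross X Y.
Proof.
rewrite -[RHS]symJK; congr symJ; apply/funext => i; apply/funext => j.
by rewrite jcrossE.
Qed.

Lemma embf_sym x y (xi eta : K) : sym3 x -> sym3 y ->
  embf x y xi eta = emb ((symJ x, symJ y, xi, eta) : P).
Proof.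
by move=> sx sy; rewrite /emb; congr embf; apply/funext => i; apply/funext => j;
  rewrite symJE.
Qed.

Lemma pcrossE p q U V (a b : K) :
  pcross p q (U, V, a, b) =
  (symJ (lieX (vsval (crossA p q)) (vsval (crossB p q)) (crossG p q) (vsval U)
    (vsval V) b),
   symJ (lieY (vsval (crossA p q)) (vsval (crossB p q)) (crossG p q) (vsval U)
     (vsval V) a),
   dot (vsval (crossA p q)) (vsval V) - tr3 (crossG p q) * a,
   dot (vsval (crossB p q)) (vsval U) + tr3 (crossG p q) * b).
Proof.
apply: emb_inj; rewrite emb_pcross [emb (U, V, a, b)]/emb.
rewrite /cross_block der_embf; try exact: jsymE.
apply: embf_sym => i j; rewrite /lieX /lieY.
  rewrite (sym3_crs (@jsymE _ (crossB p q)) (@jsymE _ V)) (jsymE (crossA p q) j)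
    (jsymE U j); ring.
rewrite (sym3_crs (@jsymE _ (crossA p q)) (@jsymE _ U)) (jsymE (crossB p q) j)
  (jsymE V j); ring.
Qed.

Lemma jent0 i j : vsval (0 : J) i j = 0. Proof. exact: mxE. Qed.

Lemma crs_0r (x : mat3) i j : crs x (vsval (0 : J)) i j = 0.
Proof. by rewrite /crs !jent0; ring. Qed.

Lemma mul3_0r (x : mat3) i j : mul3 x (vsval (0 : J)) i j = 0.
Proof. by apply: big1 => k _; rewrite jent0 mulr0. Qed.

Lemma dot_0r (x : mat3) : dot x (vsval (0 : J)) = 0.
Proof. by apply: big1 => i _; apply: big1 => j _; rewrite jent0 mulr0. Qed.

Lemma dotC (x y : mat3) : dot x y = dot y x.
Proof. by apply: eq_bigr => i _; apply: eq_bigr => j _; rewrite mulrC. Qed.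

Lemma dot_0l (x : mat3) : dot (vsval (0 : J)) x = 0.
Proof. by rewrite dotC dot_0r. Qed.

Lemma symJ_id (f : mat3) X : (forall i j, f i j = vsval X i j) -> symJ f = X.
Proof. by move=> e; rewrite -[RHS]symJK; apply: symJ_eq => i j _. Qed.

Lemma sumG0 (G : mat3) i j : \sum_k G k i * vsval (0 : J) k j = 0.
Proof. by apply: big1 => k _; rewrite jent0 mulr0. Qed.

Lemma pcross_e3 p q : pcross p q e3 = (0, crossB p q, - tr3 (crossG p q), 0).
Proof.
rewrite /e3 pcrossE mulr1 !dot_0r mulr0 sub0r addr0; congr (_, _, _, _).
  by apply: symJ_id => i j; rewrite /lieX !mul3_0r crs_0r jent0; ring.
by apply: symJ_id => i j; rewrite /lieY !sumG0 crs_0r jent0; ring.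
Qed.

Lemma pcross_e4 p q : pcross p q e4 = (crossA p q, 0, 0, tr3 (crossG p q)).
Proof.
rewrite /e4 pcrossE mulr1 !dot_0r mulr0 subr0 add0r; congr (_, _, _, _).
  by apply: symJ_id => i j; rewrite /lieX !mul3_0r crs_0r jent0; ring.
by apply: symJ_id => i j; rewrite /lieY !sumG0 crs_0r jent0; ring.
Qed.

Lemma tr3_crossG X Y Z W (xi eta zeta om : K) :
  tr3 (crossG (X, Y, xi, eta) (Z, W, zeta, om)) =
  8^-1 * (3 * (xi * om + zeta * eta) -
          (dot (vsval X) (vsval W) + dot (vsval Z) (vsval Y))).
Proof.
rewrite /tr3 /crossG /mul3 /dot !sum3 /=.
by upper (jsymE X); upper (jsymE Y); upper (jsymE Z); upper (jsymE W); field.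
Qed.

Lemma jcross0 X : jcross X 0 = 0. Proof. exact: linear0. Qed.

Lemma crossG_e3e4 i j : crossG e3 e4 i j = (i == j)%:R * 8^-1.
Proof. by rewrite /crossG /= !mul3_0r !dot_0r; ring. Qed.

Lemma tr3_crossG_e3e4 : tr3 (crossG e3 e4) = 3 / 8.
Proof. by rewrite tr3_crossG !dot_0r; field. Qed.

Lemma mul3_scalar (G : mat3) (g : K) (x : mat3) i j :
  (forall i j, G i j = (i == j)%:R * g) -> mul3 G x i j = g * x i j.
Proof.
move=> eG; rewrite -[in RHS](sum_id3 (fun k => x k j)) mulr_sumr.
by apply: eq_bigr => k _; rewrite eG mulrCA mulrA.
Qed.

(** A grading element: each [false] slot contributes -1/8 and each [true] slot 1/8, so the four
    summands have distinct eigenvalues. *)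
Lemma pcross_e3e4 X Y (xi eta : K) :
  pcross e3 e4 (X, Y, xi, eta) =
  (8^-1 *: X, - 8^-1 *: Y, - (3 / 8) * xi, 3 / 8 * eta).
Proof.
have A0 : crossA e3 e4 = 0 by rewrite /= jcross0 !scaler0 !subr0 !scaler0.
have B0 : crossB e3 e4 = 0 by rewrite /= jcross0 !scaler0 !subr0 !scaler0.
have cs x i j : crs (vsval (0 : J)) x i j = 0 by rewrite /crs !jent0; ring.
rewrite pcrossE A0 B0 tr3_crossG_e3e4 !dot_0l; congr (_, _, _, _).
- apply: symJ_id => i j; rewrite jentZ /lieX tr3_crossG_e3e4 cs jent0.
  by rewrite !(mul3_scalar _ _ _ crossG_e3e4) (jsymE X j i); field.
- apply: symJ_id => i j; rewrite jentZ /lieY tr3_crossG_e3e4 cs jent0.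
  have eG a b : \sum_k crossG e3 e4 k a * vsval Y k b = 8^-1 * vsval Y a b.
    rewrite -(mul3_scalar _ _ _ crossG_e3e4); apply: eq_bigr => k _.
    by rewrite !crossG_e3e4 eq_sym.
  by rewrite !eG (jsymE Y j i); field.
- by ring.
- by ring.
Qed.

Lemma pcross_e4e4 r : pcross e4 e4 r = 0.
Proof.
case: r => [[[U V] a] b].
have A0 : crossA e4 e4 = 0 by rewrite /= jcross0 !scaler0 !subr0 !scaler0.
have B0 : crossB e4 e4 = 0 by rewrite /= jcross0 !scaler0 !subr0 !scaler0.
have G0 i j : crossG e4 e4 i j = 0 by rewrite /crossG /= !mul3_0r !dot_0r; ring.
have t0 : tr3 (crossG e4 e4) = 0 by rewrite /tr3 big1.
have cs x i j : crs (vsval (0 : J)) x i j = 0 by rewrite /crs !jent0; ring.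
rewrite pcrossE A0 B0 t0 !dot_0l; congr (_, _, _, _);
  try by rewrite mul0r ?subr0 ?addr0.
- apply: symJ_id => i j; rewrite /lieX /mul3 t0 cs !jent0 !big1 => [|k _|k _];
  rewrite ?G0; ring.
- apply: symJ_id => i j; rewrite /lieY t0 cs !jent0 !big1 => [|k _|k _];
  rewrite ?G0; ring.
Qed.

(** Evaluation on e3 and e4 reads off the components B, A and the trace of G of p x p; their
    vanishing gives the three equations. *)
Lemma cone_eqs X Y (xi eta : K) : let p : P := (X, Y, xi, eta) in
  pcross p p e3 = 0 -> pcross p p e4 = 0 ->
  [/\ jcross X X = eta *: Y, jcross Y Y = xi *: X &
      dot (vsval X) (vsval Y) = 3 * xi * eta].
Proof.
have two : 2%:R != 0 :> K by rewrite pnatr_eq0.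
have four : 4^-1 != 0 :> K by rewrite invr_eq0 pnatr_eq0.
move=> p; rewrite pcross_e3 pcross_e4 => h3 h4.
have eB : crossB p p = 0 := congr1 (fun q : P => q.1.1.2) h3.
have eA : crossA p p = 0 := congr1 (fun q : P => q.1.1.1) h4.
have eG : tr3 (crossG p p) = 0 := congr1 (fun q : P => q.2) h4.
split.
- move/eqP: eB; rewrite /crossB /p scaler_eq0 (negPf four) /= => /eqP e.
  apply: (scalerI two); apply/eqP; rewrite -subr_eq0; apply/eqP.
  apply: (etrans _ e).
  by rewrite (scaler_nat 2 (eta *: Y)) mulr2n opprD addrA.
- move/eqP: eA; rewrite /crossA /p scaler_eq0 oppr_eq0 (negPf four) /= => /eqP e.
  apply: (scalerI two); apply/eqP; rewrite -subr_eq0; apply/eqP.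
  apply: (etrans _ e).
  by rewrite (scaler_nat 2 (xi *: X)) mulr2n opprD addrA.
- have e8 : 8^-1 != 0 :> K by rewrite invr_eq0 pnatr_eq0.
  have := eG; rewrite /p tr3_crossG => /eqP.
  rewrite mulf_eq0 (negPf e8) /= => /eqP e.
  by apply: (mulfI two); apply/eqP; rewrite eq_sym -subr_eq0 -[X in _ == X]e;
    apply/eqP; ring.
Qed.

End SpecialProducts.

(** * Every automorphism is symplectic *)

Section Surjectivity.
Variable K : numClosedFieldType.
Local Notation J := (jordan K).
Local Notation P := (freudenthal K).
Local Notation mat3 := ('I_3 -> 'I_3 -> K).
Local Notation e3 := (e3 K).
Local Notation e4 := (e4 K).
Implicit Types (p q r : P) (X Y Z W U V : J) (f : 'End(P)).

Definition in_image f := exists2 M, sympl M & f = rho M.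

Lemma preserves_pcross f p q r : preserves (@pcross K) f ->
  f (pcross p q r) = pcross (f p) (f q) (f r).
Proof. by move=> [kf hf]; rewrite -hf !comp_lfunE lker0_lfunK. Qed.

Definition pull M f : 'End(P) := ((rho M)^-1 \o f)%VF.

Lemma pull_preserves M f : sympl M -> preserves (@pcross K) f ->
  preserves (@pcross K) (pull M f).
Proof. by move=> sM; apply/preserves_comp/preserves_inv/rho_preserves. Qed.

Lemma pull_image M f : sympl M -> in_image (pull M f) -> in_image f.
Proof.
move=> sM [N sN e]; exists (mul6 M N); first exact: sympl_mul.
rewrite rho_mul // -e /pull comp_lfunA lker0_compfV ?comp_lfun1l //.
exact: rho_ker.
Qed.

Lemma pull_val M f p q : sympl M -> f p = rho M q -> pull M f p = q.
Proof. by move=> sM e; rewrite comp_lfunE e lker0_lfunK //; apply: rho_ker. Qed.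

Lemma linear_lfun (V W : vectType K) (g : V -> W) : linear g ->
  exists h : 'Hom(V, W), h =1 g.
Proof.
move=> lg; pose gL : {linear V -> W} := HB.pack g (GRing.isLinear.Build _ _ _ _ _ lg).
by exists (linfun gL) => v; rewrite lfunE.
Qed.

Definition graded f (phi psi : 'End(J)) := forall X Y (xi eta : K),
  f (X, Y, xi, eta) = (phi X, psi Y, xi, eta).

Lemma freudenthalZ (k : K) X Y (xi eta : K) :
  k *: ((X, Y, xi, eta) : P) = (k *: X, k *: Y, k * xi, k * eta).
Proof. by []. Qed.

Lemma freudenthalD X Y (xi eta : K) Z W (zeta om : K) :
  ((X, Y, xi, eta) : P) + (Z, W, zeta, om) = (X + Z, Y + W, xi + zeta, eta + om).
Proof. by []. Qed.

(** Such an f commutes with the grading element e3 x e4 and so preserves its eigenspaces. *)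
Lemma fix_graded f : preserves (@pcross K) f -> f e3 = e3 -> f e4 = e4 ->
  exists phi psi, graded f phi psi.
Proof.
move=> hf f3 f4.
have hX X : f (X, 0, 0, 0) = ((f (X, 0, 0, 0)).1.1.1, 0, 0, 0).
  have := preserves_pcross e3 e4 (X, 0, 0, 0) hf.
  rewrite f3 f4 pcross_e3e4 scaler0 !mulr0.
  have -> : (8^-1 *: X, 0, 0, 0) = 8^-1 *: ((X, 0, 0, 0) : P).
    by rewrite freudenthalZ !scaler0 !mulr0.
  rewrite linearZ /=; case: (f _) => [[[X' Y'] x'] e'] /=; rewrite pcross_e3e4.
  move=> h; congr (_, _, _, _).
  - have h1 : 8^-1 *: Y' = - 8^-1 *: Y' := congr1 (fun q : P => q.1.1.2) h.
    apply: jordanP => i j; have := congr1 (fun U : J => vsval U i j) h1.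
    (* Here and below the numerical factor is the reciprocal of the difference of two eigenvalues,
       for instance 1/8 - (-1/8) = 1/4. *)
    rewrite /= !mxE => e; transitivity (4 * (8^-1 * vsval Y' i j - (- 8^-1 *
      vsval Y' i j))); last by rewrite e subrr mulr0.
    by field.
  - have h1 : 8^-1 * x' = - (3 / 8) * x' := congr1 (fun q : P => q.1.2) h.
    by transitivity (2 * (8^-1 * x' - (- (3 / 8) * x')));
      [field | rewrite h1 subrr mulr0].
  - have h1 : 8^-1 * e' = 3 / 8 * e' := congr1 (fun q : P => q.2) h.
    by transitivity (- 4 * (8^-1 * e' - 3 / 8 * e')); [field | rewrite h1 subrr mulr0].
have hY Y : f (0, Y, 0, 0) = (0, (f (0, Y, 0, 0)).1.1.2, 0, 0).
  have := preserves_pcross e3 e4 (0, Y, 0, 0) hf.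
  rewrite f3 f4 pcross_e3e4 scaler0 !mulr0.
  have -> : (0, - 8^-1 *: Y, 0, 0) = - 8^-1 *: ((0, Y, 0, 0) : P).
    by rewrite freudenthalZ !scaler0 !mulr0.
  rewrite linearZ /=; case: (f _) => [[[X' Y'] x'] e'] /=; rewrite pcross_e3e4.
  move=> h; congr (_, _, _, _).
  - have h1 : - 8^-1 *: X' = 8^-1 *: X' := congr1 (fun q : P => q.1.1.1) h.
    apply: jordanP => i j; have := congr1 (fun U : J => vsval U i j) h1.
    rewrite /= !mxE => e; transitivity (- 4 * (- 8^-1 * vsval X' i j - (8^-1 *
      vsval X' i j))); last by rewrite e subrr mulr0.
    by field.
  - have h1 : - 8^-1 * x' = - (3 / 8) * x' := congr1 (fun q : P => q.1.2) h.
    by transitivity (4 * (- 8^-1 * x' - (- (3 / 8) * x')));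
      [field | rewrite h1 subrr mulr0].
  - have h1 : - 8^-1 * e' = 3 / 8 * e' := congr1 (fun q : P => q.2) h.
    by transitivity (- 2 * (- 8^-1 * e' - 3 / 8 * e'));
      [field | rewrite h1 subrr mulr0].
have lX : linear (fun X : J => (f (X, 0, 0, 0)).1.1.1 : J).
  move=> k X X'.
  rewrite (_ : (k *: X + X', 0, 0, 0) = k *: (X, 0, 0, 0) + (X', 0, 0, 0) :> P).
    by rewrite linearP.
  by rewrite freudenthalZ freudenthalD !scaler0 !mulr0 !addr0.
have lY : linear (fun Y : J => (f (0, Y, 0, 0)).1.1.2 : J).
  move=> k X X'.
  rewrite (_ : (0, k *: X + X', 0, 0) = k *: (0, X, 0, 0) + (0, X', 0, 0) :> P).
    by rewrite linearP.
  by rewrite freudenthalZ freudenthalD !scaler0 !mulr0 !addr0.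
have [phi ephi] := linear_lfun lX; have [psi epsi] := linear_lfun lY.
exists phi, psi => X Y xi eta.
rewrite (_ : (X, Y, xi, eta) = (X, 0, 0, 0) + (0, Y, 0, 0) + xi *: e3 + eta *:
  e4); last first.
  by rewrite !freudenthalZ !freudenthalD !scaler0 !mulr0 !mulr1 !addr0 !add0r.
rewrite !linearD !linearZ /= f3 f4 hX hY -ephi -epsi.
by rewrite !freudenthalZ !freudenthalD !scaler0 !mulr0 !mulr1 !addr0 !add0r.
Qed.

Lemma crossB_XX X X' : crossB ((X, 0, 0, 0) : P) (X', 0, 0, 0) = 2^-1 *: jcross X X'.
Proof.
rewrite /crossB !scaler0 !subr0 scalerA; congr (_ *: _); by field.
Qed.

(** On e3, the product of two elements of the first summand has (1/2) X x X' as its second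
    coordinate. [graded_dot] similarly reads the trace form off the third coordinate. *)
Lemma graded_jcross f phi psi X X' : preserves (@pcross K) f -> f e3 = e3 ->
  graded f phi psi -> psi (jcross X X') = jcross (phi X) (phi X').
Proof.
move=> hf f3 gf; have n2 : 2^-1 != 0 :> K by rewrite invr_eq0 pnatr_eq0.
have := preserves_pcross (X, 0, 0, 0) (X', 0, 0, 0) e3 hf.
rewrite f3 !gf linear0 !pcross_e3 !crossB_XX gf => h.
apply: (scalerI n2); rewrite -linearZ.
exact: (congr1 (fun q : P => q.1.1.2) h).
Qed.

Lemma graded_dot f phi psi X Y : preserves (@pcross K) f -> f e3 = e3 ->
  graded f phi psi -> dot (vsval (phi X)) (vsval (psi Y)) = dot (vsval X) (vsval Y).
Proof.
move=> hf f3 gf; have n8 : 8^-1 != 0 :> K by rewrite invr_eq0 pnatr_eq0.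
have := preserves_pcross (X, 0, 0, 0) (0, Y, 0, 0) e3 hf.
rewrite f3 !gf !linear0 !pcross_e3 !tr3_crossG gf !dot_0r => h.
have e (t : K) : - (8^-1 * (3 * (0 * 0 + 0 * 0) - (t + 0))) = 8^-1 * t by ring.
have {h} := congr1 (fun q : P => q.1.2) h; rewrite /= !e => h.
exact/esym/(mulfI n8).
Qed.

Definition Ek (k : 'I_3) : J := symJ (fun i j => ((i == k) && (j == k))%:R).
Definition Fk (k : 'I_3) : J := symJ (fun i j => [&& i != k, j != k & i != j]%:R).

Lemma EkE k i j : vsval (Ek k) i j = ((i == k) && (j == k))%:R.
Proof. by rewrite symJE // => {}i {}j; rewrite andbC. Qed.

Lemma FkE k i j : vsval (Fk k) i j = [&& i != k, j != k & i != j]%:R.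
Proof. by rewrite symJE // => {}i {}j; rewrite andbCA [i == j]eq_sym. Qed.

Lemma jordan_units X :
  X = \sum_k (vsval X k k *: Ek k + vsval X (ordS k) (ordS (ordS k)) *: Fk k).
Proof.
apply: jordanP => i j; rewrite sum3 !jentD !jentZ !EkE !FkE !ordSE.
by elim/I3_ind: i; elim/I3_ind: j; rewrite /=; upper (jsymE X); ring.
Qed.

Lemma dot_eq X Y : (forall Z, dot (vsval Z) (vsval X) = dot (vsval Z) (vsval Y))
  -> X = Y.
Proof. by move=> e; apply: jordanP => i j; rewrite -!jinner_junit !jinner_dot e. Qed.

Lemma fix_units_id f : preserves (@pcross K) f -> f e3 = e3 -> f e4 = e4 ->
  (forall k, f (Ek k, 0, 0, 0) = (Ek k, 0, 0, 0)) ->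
  (forall k, f (Fk k, 0, 0, 0) = (Fk k, 0, 0, 0)) -> in_image f.
Proof.
move=> hf f3 f4 fE fF; exists (@one6 K); first exact: sympl_one.
have [phi [psi gf]] := fix_graded hf f3 f4.
have phiX X : phi X = X.
  rewrite [in RHS](jordan_units X) [in LHS](jordan_units X) linear_sum.
  apply: eq_bigr => k _; rewrite linearD !linearZ; congr (_ *: _ + _ *: _).
    by have := fE k; rewrite gf => /(congr1 (fun q : P => q.1.1.1)).
  by have := fF k; rewrite gf => /(congr1 (fun q : P => q.1.1.1)).
rewrite rho_one; apply/lfunP => -[[[X Y] xi] eta]; rewrite gf id_lfunE phiX.
(* psi is contragredient to phi for the trace form, so it is the identity because phi is. *)
congr (_, _, _, _); apply: dot_eq => Z.
by rewrite -[in LHS](phiX Z); apply: graded_dot hf f3 gf.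
Qed.

End Surjectivity.

(** * Automorphisms fixing the diagonal units *)

Section Transitivity.
Variable K : numClosedFieldType.
Local Notation J := (jordan K).
Local Notation P := (freudenthal K).
Local Notation mat3 := ('I_3 -> 'I_3 -> K).
Local Notation e3 := (e3 K).
Local Notation e4 := (e4 K).
Local Notation Ek := (@Ek K).
Local Notation Fk := (@Fk K).
Implicit Types (p q r : P) (X Y Z W U V : J) (f : 'End(P)).

Lemma det3_cof3 (a : mat3) : det3 (cof3 a) = det3 a ^+ 2.
Proof. by rewrite /det3 /cof3 !ordSE; ring. Qed.

Lemma levi_cof_sympl (a : mat3) : det3 a = 1 -> sympl (levi a (cof3 a)).
Proof. by move=> da; apply: levi_sympl => j k; rewrite cof3_mul da mul1r. Qed.

Lemma rho_levi_J (a : mat3) X : det3 a = 1 ->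
  rho (levi a (cof3 a)) (X, 0, 0, 0) =
  (symJ (fun i j => \sum_k \sum_l a i k * vsval X k l * a j l), 0, 0, 0).
Proof.
move=> da; have sa := levi_cof_sympl da.
(* Only the first coordinate of the image was computed; the others vanish because this element of
   the image of [rho] fixes e3 and e4 and is therefore graded itself. *)
have [phi [psi gf]] : exists phi psi, graded (rho (levi a (cof3 a))) phi psi.
  apply: fix_graded; first exact: rho_preserves.
    by rewrite rho_levi_e3 da.
  by rewrite rho_levi_e4 det3_cof3 da expr1n.
have := rho_levi_X a X 0 0 0; rewrite !gf /= => ->; rewrite linear0.
by congr (symJ _, _, _, _); apply/funext => i; apply/funext => j; rewrite da mul1r.
Qed.

Lemma pull_levi (a : mat3) f : det3 a = 1 -> preserves (@pcross K) f ->
  f e3 = e3 -> f e4 = e4 -> let g := pull (levi a (cof3 a)) f in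
  [/\ preserves (@pcross K) g, g e3 = e3, g e4 = e4,
     in_image g -> in_image f &
     forall X Y, f (X, 0, 0, 0) = (Y, 0, 0, 0) ->
       forall Z, (forall i j, vsval Y i j = \sum_k \sum_l a i k * vsval Z k l * a
         j l) ->
       g (X, 0, 0, 0) = (Z, 0, 0, 0)].
Proof.
move=> da hf f3 f4 g; have sa := levi_cof_sympl da; split.
- exact: pull_preserves.
- by apply: pull_val => //; rewrite rho_levi_e3 da.
- by apply: pull_val => //; rewrite rho_levi_e4 det3_cof3 da expr1n.
- exact: pull_image.
- move=> X Y fX Z e; apply: pull_val => //; rewrite fX rho_levi_J //.
  by congr (_, _, _, _); rewrite -[LHS]symJK; congr symJ; apply/funext => i;
    apply/funext => j.
Qed.

Lemma dot_Ek X k : dot (vsval X) (vsval (Ek k)) = vsval X k k.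
Proof. by rewrite /dot !sum3 !EkE; elim/I3_ind: k; rewrite /=; ring. Qed.

Lemma jcross_Ek k : jcross (Ek (ordS k)) (Ek (ordS (ordS k))) = 2^-1 *: Ek k.
Proof.
apply: jordanP => i j; rewrite jcrossE jentZ /crs !EkE.
by elim/I3_ind: k; elim/I3_ind: i; elim/I3_ind: j; rewrite !ordSE /=; ring.
Qed.

Lemma jcross_Ek_self k : jcross (Ek k) (Ek k) = 0.
Proof.
apply: jordanP => i j; rewrite jcrossE jent0 /crs !EkE.
by elim/I3_ind: k; elim/I3_ind: i; elim/I3_ind: j; rewrite !ordSE /=; ring.
Qed.

Lemma jcross_Fk_Ek k l : l != k -> jcross (Fk k) (Ek l) = 0.
Proof.
move=> lk; apply: jordanP => i j; rewrite jcrossE jent0 /crs !EkE !FkE.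
move: lk; elim/I3_ind: k; elim/I3_ind: l => // _; elim/I3_ind: i; elim/I3_ind: j;
  by rewrite !ordSE /=; ring.
Qed.

Lemma jcross_Fk k : jcross (Fk k) (Fk k) = - Ek k.
Proof.
apply: jordanP => i j; rewrite jcrossE jentN /crs !EkE !FkE.
by elim/I3_ind: k; elim/I3_ind: i; elim/I3_ind: j; rewrite !ordSE /=; field.
Qed.

(** The two products with E_l kill two of the three off-diagonal entries, and X x X = - E_k makes
    the square of the third equal to 1. *)
Lemma Fk_unique k X : (forall l, vsval X l l = 0) ->
  (forall l, l != k -> jcross X (Ek l) = 0) -> jcross X X = - Ek k ->
  exists2 c : K, c * c = 1 & X = c *: Fk k.
Proof.
move=> X0 XE XX; exists (vsval X (ordS k) (ordS (ordS k))).
  have : crs (vsval X) (vsval X) k k = - 1 by rewrite -jcrossE XX jentN EkE eqxx.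
  rewrite /crs !X0 (jsymE X (ordS (ordS k)) (ordS k)) => e.
  by apply: oppr_inj; rewrite -[RHS]e; field.
have h l i j : l != k -> crs (vsval X) (vsval (Ek l)) i j = 0.
  by move=> lk; rewrite -jcrossE XE // jent0.
apply: jordanP => i j; rewrite jentZ FkE.
have two : 2%:R != 0 :> K by rewrite pnatr_eq0.
have z (x y : K) : y = 0 -> x = 2 * y \/ x = -2 * y -> x = 0.
  by move=> -> [] ->; rewrite mulr0.
have zk l a b : l != k -> 2 * crs (vsval X) (vsval (Ek l)) a b = 0.
  by move=> lk; rewrite h // mulr0.
move: zk; rewrite /crs; elim/I3_ind: k {XE XX h} => zk.
- have := zk o1 o2 o0 isT; have := zk o2 o0 o1 isT; rewrite !EkE !ordSE !X0 /=;
  upper (jsymE X); move=> a1 a2.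
  have x1 : vsval X o0 o1 = 0 by apply: oppr_inj; rewrite oppr0 -[RHS]a1; field.
  have x2 : vsval X o0 o2 = 0 by apply: oppr_inj; rewrite oppr0 -[RHS]a2; field.
  by elim/I3_ind: i; elim/I3_ind: j; rewrite /= ?X0; upper (jsymE X);
    rewrite ?x1 ?x2; ring.
- have := zk o0 o1 o2 isT; have := zk o2 o0 o1 isT; rewrite !EkE !ordSE !X0 /=;
  upper (jsymE X); move=> a1 a2.
  have x1 : vsval X o0 o1 = 0 by apply: oppr_inj; rewrite oppr0 -[RHS]a1; field.
  have x2 : vsval X o1 o2 = 0 by apply: oppr_inj; rewrite oppr0 -[RHS]a2; field.
  by elim/I3_ind: i; elim/I3_ind: j; rewrite /= ?X0; upper (jsymE X);
    rewrite ?x1 ?x2; ring.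
- have := zk o0 o1 o2 isT; have := zk o1 o0 o2 isT; rewrite !EkE !ordSE !X0 /=;
  upper (jsymE X); move=> a1 a2.
  have x1 : vsval X o0 o2 = 0 by apply: oppr_inj; rewrite oppr0 -[RHS]a1; field.
  have x2 : vsval X o1 o2 = 0 by apply: oppr_inj; rewrite oppr0 -[RHS]a2; field.
  by elim/I3_ind: i; elim/I3_ind: j; rewrite /= ?X0; upper (jsymE X);
    rewrite ?x1 ?x2; ring.
Qed.

Lemma fix_diagonal_image f : preserves (@pcross K) f -> f e3 = e3 -> f e4 = e4 ->
  (forall k, f (Ek k, 0, 0, 0) = (Ek k, 0, 0, 0)) -> in_image f.
Proof.
move=> hf f3 f4 fE; have [phi [psi gf]] := fix_graded hf f3 f4.
have two : 2^-1 != 0 :> K by rewrite invr_eq0 pnatr_eq0.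
have phiE k : phi (Ek k) = Ek k.
  by have := fE k; rewrite gf => /(congr1 (fun q : P => q.1.1.1)).
have psiE k : psi (Ek k) = Ek k.
  have := graded_jcross (Ek (ordS k)) (Ek (ordS (ordS k))) hf f3 gf.
  by rewrite !phiE jcross_Ek linearZ => /(scalerI two).
have Fc k : exists c : K, c * c = 1 /\ phi (Fk k) = c *: Fk k.
  have [|||c c1 ->] := @Fk_unique k (phi (Fk k)); last by exists c.
  - move=> l; rewrite -dot_Ek -psiE (graded_dot _ _ hf f3 gf) dot_Ek FkE.
    by rewrite eqxx !andbF.
  - move=> l lk; rewrite -[Ek l]phiE -(graded_jcross _ _ hf f3 gf).
    by rewrite jcross_Fk_Ek // linear0.
  - by rewrite -(graded_jcross _ _ hf f3 gf) jcross_Fk linearN /= psiE.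
have /fin_all_exists [c hc] := Fc.
have c2 k : c k * c k = 1 by have [] := hc k.
have phiF k : phi (Fk k) = c k *: Fk k by have [] := hc k.
have cF i j : vsval (c o0 *: Fk o0 + c o1 *: Fk o1 + c o2 *: Fk o2) i j =
    c o0 * vsval (Fk o0) i j + c o1 * vsval (Fk o1) i j + c o2 * vsval (Fk o2) i j.
  by rewrite !jentD !jentZ.
have F1 i j : vsval (Fk o0 + Fk o1 + Fk o2) i j =
    vsval (Fk o0) i j + vsval (Fk o1) i j + vsval (Fk o2) i j.
  by rewrite !jentD.
(* The cubic form (S, S x S) = 3 det S is invariant; it is 6 on the sum of the F_k and 6 c_0 c_1 c_2
   on its image. *)
have c1 : c o0 * c o1 * c o2 = 1.
  set S := Fk o0 + Fk o1 + Fk o2 in F1.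
  have phiS : phi S = c o0 *: Fk o0 + c o1 *: Fk o1 + c o2 *: Fk o2.
    by rewrite /S !linearD /= !phiF.
  have := graded_dot S (jcross S S) hf f3 gf.
  rewrite (graded_jcross _ _ hf f3 gf) phiS.
  have six : 6%:R != 0 :> K by rewrite pnatr_eq0.
  have jd U V W : dot (vsval U) (vsval (jcross V W)) = dot (vsval U) (crs (vsval
    V) (vsval W)).
    by apply: eq_bigr => i _; apply: eq_bigr => j _; rewrite jcrossE.
  rewrite !jd /dot /crs !sum3 !ordSE !cF !F1 !FkE /= => e.
  apply: (mulfI six); rewrite mulr1; apply: etrans (_ : _ = _) (etrans e _); by field.
(* The diagonal matrix of signs fixes every E_k and multiplies F_k by the product of the other two
   signs, which equals c_k. *)
pose a i j : K := (i == j)%:R * c i.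
have da : det3 a = 1 by rewrite -[RHS]c1 /det3 /a /=; ring.
have [hg g3 g4 gi gv] := pull_levi da hf f3 f4; apply: gi; apply: fix_units_id => // k.
- apply: (gv _ _ (fE k)) => i j; rewrite !sum3 !EkE /a.
  by elim/I3_ind: k; elim/I3_ind: i; elim/I3_ind: j;
    rewrite /= !(mul0r, mulr0, mul1r, mulr1, add0r, addr0) ?c2.
- apply: (gv _ (c k *: Fk k)); first by rewrite gf phiF linear0.
  move=> i j; rewrite jentZ !sum3 !FkE /a.
  have c01 : c o0 * c o1 = c o2 by rewrite -[RHS]mul1r -c1 -mulrA c2 mulr1.
  have c02 : c o0 * c o2 = c o1 by rewrite -c01 mulrA c2 mul1r.
  have c12 : c o1 * c o2 = c o0 by rewrite -c01 mulrCA c2 mulr1.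
  by elim/I3_ind: k; elim/I3_ind: i; elim/I3_ind: j;
    rewrite /= !(mul0r, mulr0, mul1r, mulr1, add0r, addr0) // ?c01 ?c02 ?c12 //
      mulrC ?c01 ?c02 ?c12.
Qed.

End Transitivity.

(** * Stabilisers of e3 and e4, and the chart of the cone *)

Section RankOne.
Variable K : numClosedFieldType.
Local Notation J := (jordan K).
Local Notation P := (freudenthal K).
Local Notation mat3 := ('I_3 -> 'I_3 -> K).
Local Notation e3 := (e3 K).
Local Notation e4 := (e4 K).
Local Notation Ek := (@Ek K).
Implicit Types (p q r : P) (X Y Z W U V : J) (f : 'End(P)).

Lemma jcross_self_minors X : jcross X X = 0 ->
  forall a i j, vsval X a a * vsval X i j = vsval X a i * vsval X a j.
Proof.
move=> XX; have h i j : crs (vsval X) (vsval X) i j = 0 by rewrite -jcrossE XX jent0.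
(* Each minor is, up to sign, one of the six entries of X x X; the search below finds which one and
   with which sign. *)
have z (u v w : K) : w = 0 -> u - v = w \/ u - v = - w -> u = v.
  by move=> -> e; apply/eqP; rewrite -subr_eq0; case: e => ->; rewrite ?oppr0.
move: (h o0 o0) (h o0 o1) (h o0 o2) (h o1 o1) (h o1 o2) (h o2 o2).
rewrite /crs !ordSE; upper (jsymE X); move=> h00 h01 h02 h11 h12 h22 a i j.
elim/I3_ind: a; elim/I3_ind: i; elim/I3_ind: j; upper (jsymE X);
first [ by ring | by apply: (z _ _ _ h00); first [left; field | right; field]
  | by apply: (z _ _ _ h01); first [left; by field | right; by field]
  | by apply: (z _ _ _ h02); first [left; by field | right; by field]
  | by apply: (z _ _ _ h11); first [left; by field | right; by field]
  | by apply: (z _ _ _ h12); first [left; by field | right; by field]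
  | by apply: (z _ _ _ h22); first [left; by field | right; by field]].
Qed.

Lemma rank_one X : jcross X X = 0 ->
  exists v : 'I_3 -> K, forall i j, vsval X i j = v i * v j.
Proof.
move=> /jcross_self_minors m.
have [a Xa|X0] := pickP (fun a => vsval X a a != 0).
  exists (fun i => vsval X a i / sqrtC (vsval X a a)) => i j.
  (* The root of a nonzero diagonal entry normalises its row. If the diagonal vanishes, the minors
     make every X_ij^2 zero. *)
  by rewrite mulrACA -invfM -expr2 sqrtCK -m mulrAC mulfV // mul1r.
exists (fun _ => 0) => i j; rewrite mulr0.
have d a : vsval X a a = 0 by move/eqP: (X0 a).
by have /eqP := m i j j; rewrite !d mul0r eq_sym mulf_eq0 orbb => /eqP.
Qed.

Lemma det_gram (v : mat3) (s : mat3) : (forall i j, s i j = \sum_k v k i * v k j) ->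
  dot s (crs s s) = 3 * det3 v ^+ 2.
Proof.
move=> e; have -> : dot s (crs s s) = 3 * det3 s.
  have sy : sym3 s by move=> i j; rewrite !e; apply: eq_bigr => k _; rewrite mulrC.
  by rewrite /dot /crs /det3 !sum3 !ordSE; upper sy; field.
by congr (_ * _); rewrite /det3 !e !sum3; ring.
Qed.

Lemma fix_e3_e4_image f : preserves (@pcross K) f -> f e3 = e3 -> f e4 = e4 ->
  in_image f.
Proof.
move=> hf f3 f4; have [phi [psi gf]] := fix_graded hf f3 f4.
have /fin_all_exists [v hv] k : exists v : 'I_3 -> K,
    forall i j, vsval (phi (Ek k)) i j = v i * v j.
  by apply: rank_one; rewrite -(graded_jcross _ _ hf f3 gf) jcross_Ek_self linear0.
pose E := Ek o0 + Ek o1 + Ek o2.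
have phiE i j : vsval (phi E) i j = \sum_k v k i * v k j.
  by rewrite /E (linearD phi) (linearD phi) !jentD !hv sum3.
(* phi preserves the cubic form, which is 3 on the unit matrix E and 3 det(v)^2 on its image, a Gram
   matrix. *)
have dv : det3 v ^+ 2 = 1.
  have three : 3%:R != 0 :> K by rewrite pnatr_eq0.
  apply: (mulfI three); rewrite -(det_gram phiE) mulr1.
  have jd U V W : dot (vsval U) (vsval (jcross V W)) = dot (vsval U) (crs (vsval
    V) (vsval W)).
    by apply: eq_bigr => i _; apply: eq_bigr => j _; rewrite jcrossE.
  rewrite -jd -(graded_jcross _ _ hf f3 gf) (graded_dot _ _ hf f3 gf) jd.
  have eE i j : vsval E i j = (i == j)%:R.
    rewrite !jentD !EkE; elim/I3_ind: i; elim/I3_ind: j; rewrite /=; ring.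
  by rewrite /dot /crs !sum3 !ordSE !eE /=; field.
(* Each v_k is determined only up to sign, so v_0 may be negated to reach determinant 1. *)
have [w hw dw] : exists2 w : mat3,
    forall k i j, vsval (phi (Ek k)) i j = w k i * w k j & det3 w = 1.
  move/eqP: dv; rewrite sqrf_eq1 => /orP [] /eqP dv; first by exists v.
  exists (fun k i => if k == o0 then - v k i else v k i) => [k i j|].
    by rewrite hv; case: eqP => _; rewrite ?mulrNN.
  by rewrite /det3 /= -[RHS]opprK -dv /det3; ring.
(* With the w_k as columns, a E_k a^T = w_k w_k^T. *)
pose a i k := w k i.
have da : det3 a = 1 by rewrite -dw /det3 /a; ring.
have [hg g3 g4 gi gv] := pull_levi da hf f3 f4; apply: gi.
apply: fix_diagonal_image => // k; apply: (gv _ (phi (Ek k))).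
  by rewrite gf linear0.
move=> i j; rewrite hw !sum3 !EkE /a.
by elim/I3_ind: k; rewrite /=; ring.
Qed.

Lemma fix_e4_image f : preserves (@pcross K) f -> f e4 = e4 -> in_image f.
Proof.
move=> hf f4; have n3 : 3%:R != 0 :> K by rewrite pnatr_eq0.
have e33 r : pcross e3 e3 r = 0.
  have A0 : crossA e3 e3 = 0 by rewrite /= jcross0 !scaler0 !subr0 !scaler0.
  have B0 : crossB e3 e3 = 0 by rewrite /= jcross0 !scaler0 !subr0 !scaler0.
  have G0 i j : crossG e3 e3 i j = 0 by rewrite /crossG /= !mul3_0r !dot_0r; ring.
  have t0 : tr3 (crossG e3 e3) = 0 by rewrite /tr3 big1.
  have cs x i j : crs (vsval (0 : J)) x i j = 0 by rewrite /crs !jent0; ring.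
  case: r => [[[U V] a] b].
  rewrite pcrossE A0 B0 t0 !dot_0l; congr (_, _, _, _);
    try by rewrite mul0r ?subr0 ?addr0.
  - apply: symJ_id => i j; rewrite /lieX /mul3 t0 cs !jent0 !big1 => [|k _|k _];
    rewrite ?G0; ring.
  - apply: symJ_id => i j; rewrite /lieY t0 cs !jent0 !big1 => [|k _|k _];
    rewrite ?G0; ring.
case ep : (f e3) => [[[X Y] xi] eta].
have h r : pcross (f e3) (f e3) r = 0.
  have [kf _] := hf; rewrite -(lker0_lfunVK kf r) -preserves_pcross // e33;
    exact: linear0.
have [XX YY XY] : [/\ jcross X X = eta *: Y, jcross Y Y = xi *: X &
      dot (vsval X) (vsval Y) = 3 * xi * eta].
  by apply: cone_eqs; rewrite -ep.
(* e4 is an eigenvector of e3 x e4 for 3/8, hence also of f e3 x e4, whose eigenvalue on the last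
   coordinate is 3 xi / 8. *)
have xi1 : xi = 1.
  have n8 : 3 / 8 != 0 :> K by rewrite mulf_neq0 ?invr_eq0 ?pnatr_eq0.
  have := preserves_pcross e3 e4 e4 hf.
  rewrite f4 ep {1}/e4 pcross_e3e4 pcross_e4 !scaler0 mulr0 mulr1.
  have -> : (0, 0, 0, 3 / 8) = (3 / 8) *: e4 by rewrite freudenthalZ !scaler0
    mulr0 mulr1.
  rewrite linearZ /= f4 => /(congr1 (fun q : P => q.2)) /=.
  rewrite tr3_crossG !dot_0r dot_0l /= => e; apply: (mulfI n8).
  by rewrite [RHS]e; field.
move: YY XY ep; rewrite xi1 scale1r mulr1 => YY XY ep.
have sY : sym3 (vsval Y) by exact: jsymE.
have sM := uni_lo_sympl sY; apply: (pull_image sM); apply: fix_e3_e4_image.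
- exact: pull_preserves.
(* Now X = Y x Y, and (X, Y) = 3 eta gives eta = det Y; thus f e3 is the image of e3 under the
   unipotent element of Y. *)
- apply: pull_val => //; rewrite ep rho_uni_lo_e3 // symJ_jcross symJK YY.
  congr (_, _, _, _); apply: (mulfI n3); rewrite -XY -YY.
  rewrite /dot /crs /det3 !sum3.
  by rewrite !jcrossE /crs !ordSE; upper (jsymE Y); field.
- by apply: pull_val => //; rewrite f4 rho_uni_lo_e4.
Qed.

Lemma jcrossC X Y : jcross X Y = jcross Y X.
Proof.
apply: jordanP => i j; rewrite [LHS]jcrossE [RHS]jcrossE /crs.
move: (vsval X _ _) (vsval X _ _) (vsval X _ _) (vsval X _ _).
by move: (vsval Y _ _) (vsval Y _ _) (vsval Y _ _) (vsval Y _ _) => *; ring.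
Qed.

Lemma jcross_scale (c : K) X : jcross (c *: X) (c *: X) = (c * c) *: jcross X X.
Proof.
have e U V : jcross U (c *: V) = c *: jcross U V by exact: linearZ.
by rewrite e (jcrossC (c *: X)) e scalerA.
Qed.

Lemma last_neq0_image f : preserves (@pcross K) f -> (f e4).2 != 0 -> in_image f.
Proof.
move=> hf; have n3 : 3%:R != 0 :> K by rewrite pnatr_eq0.
case ep : (f e4) => [[[X Y] xi] eta] /= eta0.
have h r : pcross (f e4) (f e4) r = 0.
  have [kf _] := hf; rewrite -(lker0_lfunVK kf r) -preserves_pcross //
    pcross_e4e4; exact: linear0.
have [XX YY XY] : [/\ jcross X X = eta *: Y, jcross Y Y = xi *: X &
      dot (vsval X) (vsval Y) = 3 * xi * eta].
  by apply: cone_eqs; rewrite -ep.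
(* The target is f e4 = eta times the image of e4 under [uni_hi] of Z, whose first coordinate forces
   this Z. The existential keeps Z from being unfolded. *)
have [Z eZ'] : exists Z, Z = eta^-1 *: X by exists (eta^-1 *: X).
have sZ : sym3 (vsval Z) by exact: jsymE.
have sM := uni_hi_sympl sZ; apply: (pull_image sM).
(* diag(eta, 1, 1) has determinant eta, the factor by which the block diagonal element multiplies
   e4; a is its inverse. *)
pose d i j : K := (i == j)%:R * (if i == o0 then eta else 1).
pose a i j : K := (i == j)%:R * (if i == o0 then eta^-1 else 1).
have sN : sympl (levi a d).
  apply: levi_sympl => j k; rewrite sum3 /a /d.
  by elim/I3_ind: j; elim/I3_ind: k;
    rewrite /= ?mul0r ?mulr0 ?addr0 ?add0r ?mul1r ?mulr1 ?mulVf.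
have dd : det3 d = eta by rewrite /det3 /d /=; ring.
have hg := pull_preserves sM hf; apply: (pull_image sN).
apply: fix_e4_image; first exact: pull_preserves.
apply: pull_val => //; rewrite rho_levi_e4 dd; apply: pull_val => //.
have -> : (0, 0, 0, eta) = eta *: e4 by rewrite freudenthalZ !scaler0 mulr0 mulr1.
rewrite linearZ /= rho_uni_hi_e4 // symJK symJ_jcross freudenthalZ ep mulr1.
have eZ : eta *: Z = X by rewrite eZ' scalerA mulfV ?scale1r.
have ZZ : jcross Z Z = eta^-1 *: Y.
  apply: (scalerI eta0); apply: (scalerI eta0).
  have eY : eta *: (eta^-1 *: Y) = Y by rewrite scalerA mulfV ?scale1r.
  by rewrite eY -XX -eZ jcross_scale scalerA.
rewrite eZ ZZ scalerA mulfV // scale1r; congr (_, _, _, _).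
apply: (mulfI n3); apply: (mulfI eta0); transitivity (dot (vsval X) (vsval Y)).
  by rewrite XY; ring.
have -> : Y = eta *: jcross Z Z by rewrite ZZ scalerA mulfV ?scale1r.
rewrite -eZ; transitivity (eta * eta * dot (vsval Z) (crs (vsval Z) (vsval Z))).
  rewrite /dot mulr_sumr; apply: eq_bigr => i _; rewrite mulr_sumr;
    apply: eq_bigr => j _.
  by rewrite (jentZ eta Z) (jentZ eta (jcross Z Z)) jcrossE; ring.
rewrite /dot /crs /det3 !sum3 !ordSE; upper (jsymE Z); by field.
Qed.

End RankOne.

(** * Every automorphism lies in the image *)

Section Image.
Variable K : numClosedFieldType.
Local Notation J := (jordan K).
Local Notation P := (freudenthal K).
Local Notation mat3 := ('I_3 -> 'I_3 -> K).
Local Notation e4 := (e4 K).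
Implicit Types (p q r : P) (X Y : J) (f : 'End(P)).

Definition sym6 (a b c d e f : K) : mat3 := fun i j =>
  match i : nat, j : nat with
  | 0, 0 => a | 1, 1 => b | 2, 2 => c
  | 0, 1 | 1, 0 => d | 0, 2 | 2, 0 => e | 1, 2 | 2, 1 => f
  | _, _ => 0
  end.

Lemma sym6_sym (a b c d e f : K) : sym3 (sym6 a b c d e f).
Proof. by move=> i j; elim/I3_ind: i; elim/I3_ind: j. Qed.

Lemma uni_lo_last_eq0 p :
  (forall y, sym3 y -> (rho (uni_lo y) p).2 = 0) -> p = 0.
Proof.
case: p => [[[X Y] xi] eta] h.
have {}h (a b c d e f : K) : eta + dot (sym6 a b c d e f) (vsval X) +
    dot (crs (sym6 a b c d e f) (sym6 a b c d e f)) (vsval Y) +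
    xi * det3 (sym6 a b c d e f) = 0.
  by rewrite -rho_uni_lo_last; [apply: h|]; apply: sym6_sym.
move: h; rewrite /dot /crs /det3 => h.
have {}h (a b c d e f : K) : eta + (a * vsval X o0 o0 + b * vsval X o1 o1 + c *
  vsval X o2 o2 +
     2 * (d * vsval X o0 o1 + e * vsval X o0 o2 + f * vsval X o1 o2)) +
    ((b * c - f * f) * vsval Y o0 o0 + (a * c - e * e) * vsval Y o1 o1 +
     (a * b - d * d) * vsval Y o2 o2 + 2 * ((f * e - d * c) * vsval Y o0 o1 +
     (d * f - b * e) * vsval Y o0 o2 + (d * e - a * f) * vsval Y o1 o2)) +
    xi * (a * b * c + 2 * (d * e * f) - a * f * f - b * e * e - c * d * d) = 0.
  rewrite -[RHS](h a b c d e f) !sum3 !ordSE /sym6 /=.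
  by upper (jsymE X); upper (jsymE Y); field.
have two (x : K) : 2 * x = 0 -> x = 0.
  by move/eqP; rewrite mulf_eq0 pnatr_eq0 => /eqP.
(* The coefficients are extracted by evaluation. Matrices y of rank one leave only X, those of rank
   two give the diagonal of Y, and the unit matrix gives xi. At the last three points a diagonal
   entry -1 keeps a single off-diagonal entry of Y alive. *)
have eta0 : eta = 0 by rewrite -[RHS](h 0 0 0 0 0 0); ring.
have x00 : vsval X o0 o0 = 0 by rewrite -[RHS](h 1 0 0 0 0 0) eta0; ring.
have x11 : vsval X o1 o1 = 0 by rewrite -[RHS](h 0 1 0 0 0 0) eta0; ring.
have x22 : vsval X o2 o2 = 0 by rewrite -[RHS](h 0 0 1 0 0 0) eta0; ring.
have x01 : vsval X o0 o1 = 0.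
  by apply: two; rewrite -[RHS](h 1 1 0 1 0 0) eta0 x00 x11; ring.
have x02 : vsval X o0 o2 = 0.
  by apply: two; rewrite -[RHS](h 1 0 1 0 1 0) eta0 x00 x22; ring.
have x12 : vsval X o1 o2 = 0.
  by apply: two; rewrite -[RHS](h 0 1 1 0 0 1) eta0 x11 x22; ring.
have y00 : vsval Y o0 o0 = 0 by rewrite -[RHS](h 0 1 1 0 0 0) eta0 x11 x22; ring.
have y11 : vsval Y o1 o1 = 0 by rewrite -[RHS](h 1 0 1 0 0 0) eta0 x00 x22; ring.
have y22 : vsval Y o2 o2 = 0 by rewrite -[RHS](h 1 1 0 0 0 0) eta0 x00 x11; ring.
have xi0 : xi = 0.
  by rewrite -[RHS](h 1 1 1 0 0 0) eta0 x00 x11 x22 y00 y11 y22; ring.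
have y01 : vsval Y o0 o1 = 0.
  by apply: two; rewrite -[RHS](h 0 0 (-1) 1 0 0) eta0 x22 x01 y22 xi0; ring.
have y02 : vsval Y o0 o2 = 0.
  by apply: two; rewrite -[RHS](h 0 (-1) 0 0 1 0) eta0 x11 x02 y11 xi0; ring.
have y12 : vsval Y o1 o2 = 0.
  by apply: two; rewrite -[RHS](h (-1) 0 0 0 0 1) eta0 x00 x12 y00 xi0; ring.
rewrite eta0 xi0; congr (_, _, _, _); apply: jordanP => i j; rewrite jent0.
  by elim/I3_ind: i; elim/I3_ind: j; upper (jsymE X).
by elim/I3_ind: i; elim/I3_ind: j; upper (jsymE Y).
Qed.

(** Since f e4 is nonzero, some lower unipotent element moves it to a vector with nonzero last
    coordinate, where [last_neq0_image] applies. *)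
Lemma preserves_image f : preserves (@pcross K) f -> in_image f.
Proof.
move=> hf; have [kf _] := hf.
have [y sy hy] : exists2 y : mat3, sym3 y & (rho (uni_lo y) (f e4)).2 != 0.
  apply/not_exists2P => h; have : f e4 = 0.
    by apply: uni_lo_last_eq0 => y sy; case: (h y) => // /negP; rewrite negbK => /eqP.
  rewrite -[RHS](linear0 f) => /(lker0P kf)/(congr1 (fun q : P => q.2))/eqP.
  by rewrite /= oner_eq0.
have sM := uni_lo_sympl sy.
have [N sN e] : in_image (rho (uni_lo y) \o f)%VF.
  apply: last_neq0_image; last by rewrite comp_lfunE.
  exact/preserves_comp/hf/rho_preserves.
have sy' : sym3 (fun i j => - y i j) by move=> i j; rewrite sy.
exists (mul6 (uni_lo (fun i j => - y i j)) N).
  exact/sympl_mul/sN/uni_lo_sympl.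
by rewrite rho_mul // -e comp_lfunA -rho_mul // uni_loK rho_one comp_lfun1l.
Qed.

End Image.

(** * Quaternionic matrices *)

Section QuaternionMatrices.
Variable K : numClosedFieldType.
Implicit Types (p q : quat K) (M : idx -> idx -> K) (A : 'M[quat K]_3).

(* H^C is the algebra of 2 x 2 complex matrices, conjugation being the adjugate. *)
Definition chi q (s t : bool) : K :=
  match s, t with
  | false, false => qre q + 'i * qi q | false, true => qj q + 'i * qk q
  | true, false => - qj q + 'i * qk q | true, true => qre q - 'i * qi q
  end.

Let ii : ('i : K) * 'i + 1 = 0.
Proof. by rewrite -expr2 sqrCi addNr. Qed.

Lemma chiM p q s t : chi (p * q) s t = \sum_u chi p s u * chi q u t.
Proof.
(* [ring] does not know that 'i squares to -1, so the difference of the two sides is exhibited as a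
   multiple z of 'i * 'i + 1. *)
have red (x y z : K) : x = y + ('i * 'i + 1) * z -> y = x by rewrite ii mul0r addr0.
rewrite big_bool quat_mulE; move: s t => [] []; rewrite /= !qmkE.
- by apply: (red _ _ (qi p * qi q + qk p * qk q)); ring.
- by apply: (red _ _ (qk p * qi q - qi p * qk q)); ring.
- by apply: (red _ _ (qi p * qk q - qk p * qi q)); ring.
- by apply: (red _ _ (qi p * qi q + qk p * qk q)); ring.
Qed.

Lemma chiD p q s t : chi (p + q) s t = chi p s t + chi q s t.
Proof. by move: s t => [] [] /=; rewrite !qDE; ring. Qed.

Lemma chiZ k q s t : chi (k *: q) s t = k * chi q s t.
Proof. by move: s t => [] [] /=; rewrite !qZE; ring. Qed.

Lemma chi0 s t : chi 0 s t = 0.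
Proof. by rewrite -(scale0r (0 : quat K)) chiZ mul0r. Qed.

Lemma chi1 s t : chi 1 s t = (s == t)%:R.
Proof. by move: s t => [] [] /=; rewrite -[1 : quat K]/(quat_one K) !qmkE; ring. Qed.

Lemma chi_sum (I : Type) (r : seq I) (F : I -> quat K) s t :
  chi (\sum_(i <- r) F i) s t = \sum_(i <- r) chi (F i) s t.
Proof. by elim/big_rec2: _ => [|i x y _ <-]; rewrite ?chi0 ?chiD. Qed.

Lemma chi_conj q s t :
  chi (quat_conj q) s t = (if s == t then 1 else -1) * chi q (~~ t) (~~ s).
Proof. by move: s t => [] [] /=; rewrite !qmkE; ring. Qed.

Definition unchi (m : bool -> bool -> K) : quat K :=
  mkquat (2^-1 * (m false false + m true true))
         (2^-1 * ('i * (m true true - m false false)))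
         (2^-1 * (m false true - m true false))
         (- 2^-1 * ('i * (m false true + m true false))).

Lemma chiK q : unchi (chi q) = q.
Proof.
have red (x y z : K) : x = y + ('i * 'i + 1) * z -> x = y by rewrite ii mul0r addr0.
apply: quatP; rewrite !qmkE /=.
- by field.
- by apply: (red _ _ (- qi q)); field.
- by field.
- by apply: (red _ _ (- qk q)); field.
Qed.

Lemma unchiK m s t : chi (unchi m) s t = m s t.
Proof.
have red (x y z : K) : x = y + ('i * 'i + 1) * z -> x = y by rewrite ii mul0r addr0.
move: s t => [] [] /=; rewrite !qmkE.
- by apply: (red _ _ (2^-1 * (m false false - m true true))); field.
- by apply: (red _ _ (- 2^-1 * (m false true + m true false))); field.
- by apply: (red _ _ (- 2^-1 * (m false true + m true false))); field.
- by apply: (red _ _ (2^-1 * (m true true - m false false))); field.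
Qed.

Lemma chi_inj p q : (forall s t, chi p s t = chi q s t) -> p = q.
Proof.
move=> e; rewrite -[p]chiK -[q]chiK; congr unchi.
by apply/funext => s; apply/funext => t.
Qed.

Definition chimx A (a b : idx) : K := chi (A a.1 b.1) a.2 b.2.

Definition unchimx M : 'M[quat K]_3 :=
  \matrix_(i, j) unchi (fun s t => M (i, s) (j, t)).

Lemma chimxK A : unchimx (chimx A) = A.
Proof. by apply/matrixP => i j; rewrite mxE; exact: chiK. Qed.

Lemma unchimxK M : chimx (unchimx M) = M.
Proof. by apply/funext => -[i s]; apply/funext => -[j t];
  rewrite /chimx mxE unchiK. Qed.

Lemma chimxM A B : chimx (A *m B) = mul6 (chimx A) (chimx B).
Proof.
apply/funext => -[i s]; apply/funext => -[j t]; rewrite /chimx mxE chi_sum /mul6.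
rewrite sum_idx -big_split; apply: eq_bigr => k _.
by rewrite chiM big_bool /= addrC.
Qed.

(** As conjugation is the adjugate, which is transposition twisted by J, the form on columns is an
    entry of [qadj A *m A]. *)
Lemma chimx_pairing A j s k t :
  \sum_b sgn K b * chimx A b (j, s) * chimx A (star b) (k, t) =
  sgn K (j, s) * chi ((qadj A *m A) j k) (~~ s) t.
Proof.
rewrite mxE chi_sum mulr_sumr sum_idx -big_split; apply: eq_bigr => i _.
rewrite !mxE chiM big_bool !chi_conj /sgn /star /chimx /=.
by case: s; case: t; rewrite /=; ring.
Qed.

Lemma chimx_sympl A : A *m qadj A = 1%:M <-> sympl (chimx A).
Proof.
(* Preservation of J concerns [qadj A *m A], whereas the group is defined by the opposite product;
   [qmulmx1C] exchanges them. *)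
split=> [/qmulmx1C AA [j s] [k t]|sA].
  rewrite chimx_pairing AA mxE /star xpair_eqE /= [k == j]eq_sym.
  case: eqP => _ /=; last by rewrite mulr0n chi0 mulr0.
  by rewrite mulr1n chi1 eq_sym; case: eqP; rewrite (mulr1, mulr0).
apply: qmulmx1C; apply/matrixP => j k; apply: chi_inj => s t.
have /(congr1 (fun x => sgn K (j, ~~ s) * x)) := sA (j, ~~ s) (k, t).
rewrite chimx_pairing mulrA sgn_sqr mul1r negbK => ->.
rewrite /star xpair_eqE /= negbK mxE [k == j]eq_sym; case: eqP => _ /=; last first.
  by rewrite mulr0n chi0 mulr0.
by rewrite mulr1n chi1 eq_sym; case: eqP; rewrite ?mulr0 ?sgn_sqr.
Qed.

End QuaternionMatrices.

(** * Holomorphy *)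

Section Recovery.
Variable K : numFieldType.
Local Notation J := (jordan K).
Local Notation P := (freudenthal K).
Local Notation e3 := (e3 K).
Local Notation e4 := (e4 K).
Implicit Types (p q r : P) (X Y : J) (f : 'End(P)) (M : idx -> idx -> K).
Implicit Types (a d n x y : idx).

Local Notation c0 := ((o0, false) : idx).

(** The disjunction gives the entry 1 at the corner when i is 0, while [col_unit] has 2 there, as
    the symmetric square of the first basis vector requires. *)
Definition row_unit (i : 'I_3) : J :=
  symJ (fun k l => ((k == o0) && (l == i) || (k == i) && (l == o0))%:R).
Definition col_unit (i : 'I_3) : J :=
  symJ (fun k l => ((k == o0) && (l == i))%:R + ((k == i) && (l == o0))%:R).
Definition corner : J := symJ (fun k l => ((k == o0) && (l == o0))%:R).

Lemma row_unitE i k l :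
  vsval (row_unit i) k l = ((k == o0) && (l == i) || (k == i) && (l == o0))%:R.
Proof. by rewrite symJE // => {}k {}l; rewrite orbC ![(_ == _) && (l == _)]andbC. Qed.

Lemma col_unitE i k l :
  vsval (col_unit i) k l = ((k == o0) && (l == i))%:R + ((k == i) && (l == o0))%:R.
Proof. by rewrite symJE // => {}k {}l; rewrite addrC ![(_ == _) && (l == _)]andbC. Qed.

Lemma cornerE k l : vsval corner k l = ((k == o0) && (l == o0))%:R.
Proof. by rewrite symJE // => {}k {}l; rewrite andbC. Qed.

Definition cross_sum p q a d : K :=
  16^-1 * (contr (emb p) (emb q) a d + contr (emb q) (emb p) a d).

Lemma cross_sumE p q a d : cross_sum p q a d = cross_block p q a d.
Proof. by rewrite /cross_sum contr_emb mulrA mulVf ?mul1r // pnatr_eq0. Qed.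

(* For f = rho M these are the symmetrised products of the entries of the first
   column of M with those of column n. *)
Definition col_prod f n a d : K :=
  if n.2 then 4 * cross_sum (f (corner, 0, 0, 0)) (f (0, row_unit n.1, 0, 0)) a d +
    (n.1 == o0)%:R * (4 * cross_sum (f e3) (f e4) a d)
  else 4 * cross_sum (f (col_unit n.1, 0, 0, 0)) (f e3) a d.

Lemma jcross_0l X : jcross 0 X = 0.
Proof. by apply: jordanP => i j; rewrite jcrossE jent0 /crs !jent0; ring. Qed.

(** The chosen vectors are made so that the identity gives the symmetric product of the basis
    vectors [c0] and n of V; equivariance then transports it to any symplectic M. *)
Lemma col_prod_id n x y : col_prod \1%VF n x y =
  ((x == c0) && (y == n))%:R + ((x == n) && (y == c0))%:R.
Proof.
rewrite /col_prod !id_lfunE !cross_sumE /cross_block.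
case: n => [i [|]]; rewrite [(_, _).2]/= [(_, _).1]/=.
- have -> : crossA (corner, 0, 0, 0) (0, row_unit i, 0, 0) = 0.
    by rewrite /crossA jcross_0l !scaler0 scale0r !subr0 scaler0.
  have -> : crossB (corner, 0, 0, 0) (0, row_unit i, 0, 0) = 0.
    by rewrite /crossB jcross0 !scaler0 scale0r !subr0 scaler0.
  have -> : crossA e3 e4 = 0 by rewrite /= jcross0 !scaler0 !subr0 !scaler0.
  have -> : crossB e3 e4 = 0 by rewrite /= jcross0 !scaler0 !subr0 !scaler0.
  (* The factor 4 undoes the 1/4 in [crossG]. For i = 0 the scalar term -1/8 of the first product is
     cancelled by 1/8 from e3 x e4. *)
  have eG k l : 4 * crossG (corner, 0, 0, 0) (0, row_unit i, 0, 0) k l +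
      (i == o0)%:R * (4 * crossG e3 e4 k l) = ((k == o0) && (l == i))%:R.
    rewrite crossG_e3e4 /crossG !mul3_0r !dot_0r /mul3 /dot !sum3 !cornerE !row_unitE.
    by elim/I3_ind: i; elim/I3_ind: k; elim/I3_ind: l; rewrite /=; field.
  move: (crossG (corner, _, _, _) _) (crossG e3 e4) eG => G1 G2 eG.
  case: x y => [k s] [l t]; rewrite !xpair_eqE.
  case: s t => [] [] /=; rewrite ?andbT ?andbF /= ?andbF ?andbT ?jent0; try by ring.
    by rewrite eG add0r [_ && (k == _)]andbC.
  by rewrite eG addr0.
- have -> : crossA (col_unit i, 0, 0, 0) e3 = 4^-1 *: col_unit i.
    rewrite /crossA /e3 jcross0 !scaler0 subr0 sub0r scale1r.
    by rewrite scalerN scaleNr opprK.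
  have -> : crossB (col_unit i, 0, 0, 0) e3 = 0.
    by rewrite /crossB /e3 jcross0 !scaler0 !subr0 scaler0.
  have eG k l : crossG (col_unit i, 0, 0, 0) e3 k l = 0.
    by rewrite /crossG /= !mul3_0r !dot_0r; ring.
  move: (crossG (col_unit i, _, _, _) _) eG => G eG.
  have eA k l : vsval (4^-1 *: col_unit i) k l =
      4^-1 * (((k == o0) && (l == i))%:R + ((k == i) && (l == o0))%:R).
    by rewrite jentZ col_unitE.
  move: (4^-1 *: col_unit i) eA => A eA.
  case: x y => [k s] [l t]; rewrite !xpair_eqE.
  case: s t => [] [] /=; rewrite ?eG ?andbT ?andbF /= ?andbF ?andbT ?jent0; try by ring.
  by rewrite eA; field.
Qed.

Lemma cross_sum_rho M p q a d : sympl M ->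
  cross_sum (rho M p) (rho M q) a d = \sum_x \sum_y M a x * M d y * cross_sum p q x y.
Proof.
move=> sM; rewrite cross_sumE cross_block_rho //.
by apply: eq_bigr => x _; apply: eq_bigr => y _; rewrite cross_sumE.
Qed.

Lemma sum_delta2 M a d x y :
  \sum_u \sum_v M a u * M d v * ((u == x) && (v == y))%:R = M a x * M d y.
Proof.
rewrite (bigD1 x) //= (bigD1 y) //= !eqxx mulr1 !big1 ?addr0 // => [u /negPf ux|v
  /negPf vy].
  by rewrite big1 // => v _; rewrite ux mulr0.
by rewrite vy mulr0.
Qed.

Lemma col_prod_rho M n a d : sympl M ->
  col_prod (rho M) n a d = M a c0 * M d n + M a n * M d c0.
Proof.
move=> sM; rewrite -2!sum_delta2 -big_split /=.
under [RHS]eq_bigr do rewrite -big_split /=.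
under [RHS]eq_bigr => x _ do under eq_bigr => y _ do rewrite -mulrDr -col_prod_id.
rewrite /col_prod; case: ifP => _; rewrite !cross_sum_rho // !id_lfunE.
  rewrite !mulr_sumr -big_split; apply: eq_bigr => x _ /=.
  by rewrite !mulr_sumr -big_split; apply: eq_bigr => y _ /=; ring.
rewrite mulr_sumr; apply: eq_bigr => x _.
by rewrite mulr_sumr; apply: eq_bigr => y _; rewrite mulrCA.
Qed.

(** For f = rho M the quotient equals M a n * M d c0, the unwanted half of the symmetrised product;
    what remains is M a c0 * M d n. *)
Definition col_scaled f a d n : K :=
  col_prod f n a d - col_prod f n a a * col_prod f c0 a d / (2 * col_prod f c0 a a).

(** With m = M a c0, the numerator is m (M d n) times m^3 times a minor, and the denominator is the
    minor times (m^2)^2. Only m^2 is needed, so no root is extracted. *)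
Definition recover f a (t : idx * idx * idx) d n : K :=
  col_scaled f a d n * cube (col_scaled f a) (emb e3) t.1.1 t.1.2 t.2 /
  (emb (f e3) t.1.1 t.1.2 t.2 * (2^-1 * col_prod f c0 a a) ^+ 2).

Lemma col_scaled_rho M a d n : sympl M -> M a c0 != 0 ->
  col_scaled (rho M) a d n = M a c0 * M d n.
Proof.
move=> sM nz; rewrite /col_scaled !col_prod_rho //.
have nz2 : M a c0 * M a c0 + M a c0 * M a c0 != 0.
  by rewrite -mulr2n mulrn_eq0 /= mulf_neq0.
field; exact: nz2.
Qed.

(* The quadratic data col_prod determine M up to sign, and the cubic minors
   fix the sign. *)
Lemma recover_rho M a t d n : sympl M -> M a c0 != 0 ->
  emb (rho M e3) t.1.1 t.1.2 t.2 != 0 -> recover (rho M) a t d n = M d n.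
Proof.
move=> sM nz tz; rewrite /recover.
have -> : col_scaled (rho M) a = fun u v => M a c0 * M u v.
  by apply/funext => u; apply/funext => v; rewrite col_scaled_rho.
have -> : cube (fun u v => M a c0 * M u v) (emb e3) t.1.1 t.1.2 t.2 =
    M a c0 ^+ 3 * emb (rho M e3) t.1.1 t.1.2 t.2.
  rewrite emb_rho // !cubeE mulr_sumr; apply: eq_bigr => u _.
  by rewrite /coef3 /=; ring.
rewrite col_prod_rho //; move: (emb _ _ _ _) tz => E Ez.
by field; rewrite Ez /= -mulr2n mulrn_eq0 /= mulf_neq0.
Qed.

Lemma sympl_col_neq0 M n : sympl M -> exists a, M a n != 0.
Proof.
move=> sM; have [a na|M0] := pickP (fun a => M a n != 0); first by exists a.
have := sM n (star n); rewrite eqxx big1 => [|b _].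
  by rewrite /sgn => /esym/eqP; case: ifP => _; rewrite ?oppr_eq0 oner_eq0.
by rewrite (eqP (negbFE (M0 b))) mulr0 mul0r.
Qed.

Lemma emb_neq0 p : p != 0 -> exists t, emb p t.1.1 t.1.2 t.2 != 0.
Proof.
move=> np; have [t nt|T0] := pickP (fun t : idx * idx * idx => emb p t.1.1 t.1.2
  t.2 != 0).
  by exists t.
case/eqP: np; rewrite -[LHS]embK -[RHS]proj0; congr proj.
apply/funext => a; apply/funext => b; apply/funext => c.
exact/eqP/negbFE/(T0 (a, b, c)).
Qed.

Lemma rho_e3_neq0 M : sympl M -> rho M e3 != 0.
Proof.
move=> sM; apply/eqP => e0; have := lker0P (rho_ker sM) e3 0.
rewrite linear0 => /(_ e0)/(congr1 (fun q : P => q.1.2))/eqP.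
by rewrite /= oner_eq0.
Qed.

Lemma rho_inj M M' : sympl M -> sympl M' -> rho M = rho M' -> M = M'.
Proof.
move=> sM sM' e; have [a na] := sympl_col_neq0 c0 sM.
have [t nt] := emb_neq0 (rho_e3_neq0 sM).
(* The square of this entry is determined by the common image, so one choice of a and t serves both
   matrices. *)
have na' : M' a c0 != 0.
  have := col_prod_rho c0 a a sM; rewrite e col_prod_rho // -!mulr2n.
  move=> /eqP h; apply/eqP => z; move: h; rewrite z mulr0 mul0rn eq_sym.
  by rewrite mulrn_eq0 /= mulf_eq0 (negPf na).
apply/funext => d; apply/funext => n.
have nt' : emb (rho M' e3) t.1.1 t.1.2 t.2 != 0 by rewrite -e.
apply: etrans (esym (recover_rho d n sM na nt)) _.
by rewrite e; apply: recover_rho.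
Qed.

End Recovery.

(** * Differentiability of sums, rows and linear forms *)

Section Differentiability.
Variables (K : numFieldType) (V : normedModType K).

Lemma differentiable_fsum (I : finType) (F : I -> V -> K) (y : V) :
  (forall i, differentiable (F i) y) -> differentiable (fun z => \sum_i F i z) y.
Proof.
move=> dF; rewrite (_ : (fun z => _) = \sum_i F i).
  by elim/big_ind: _ => // f g df dg; apply: differentiableD.
by apply/funext => z; rewrite fct_sumE.
Qed.

Lemma differentiable_row n (h : 'I_n -> V -> K) (y : V) :
  (forall i, differentiable (h i) y) -> differentiable (fun z => \row_i h i z) y.
Proof.
move=> dh; rewrite (_ : (fun z => _) = \sum_(i < n) (fun z => h i z *: delta_mx 0 i)).
  by apply: differentiable_sum => i; apply: differentiableZl.
apply/funext => z; rewrite fct_sumE [LHS]row_sum_delta.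
by apply: eq_bigr => i _; rewrite mxE.
Qed.

Lemma near_differentiable_neq0 (h : V -> K) (y : V) :
  differentiable h y -> h y != 0 -> \forall z \near y, h z != 0.
Proof. by move=> /differentiable_continuous hc; apply: cvgr_neq0. Qed.

End Differentiability.

Lemma differentiable_scalar (K : numFieldType) n (h : 'rV[K]_n -> K) (y : 'rV[K]_n) :
  scalar h -> differentiable h y.
Proof.
move=> lh; pose hL : {scalar 'rV[K]_n} := HB.pack h (GRing.isLinear.Build _ _ _ _ _ lh).
rewrite (_ : h = fun z => \sum_j z 0 j * h (delta_mx 0 j)).
  apply: differentiable_fsum => j; apply: differentiableM.
    exact: differentiable_coord.
  exact: differentiable_cst.
apply/funext => z; rewrite -[LHS]/(hL z) {1}[z]row_sum_delta linear_sum.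
by apply: eq_bigr => j _; rewrite linearZ.
Qed.

Lemma vbasis_coordK (K : fieldType) (V : vectType K) (v : V) :
  \sum_i coord (vbasis {:V}) i v *: (vbasis {:V})`_i = v.
Proof. by rewrite -(coord_vbasis (memvf v)). Qed.

(** * Differentiability of the representation and of the recovery formula *)

Section Holomorphy.
Variable K : numClosedFieldType.
Local Notation P := (freudenthal K).
Local Notation e3 := (e3 K).
Local Notation c0 := ((o0, false) : idx).

(** Inverts the coordinate map, on the whole ambient space: formulas in a group element thereby
    extend off the group. *)
Definition of_coord (V : vectType K) (y : 'rV[K]_(\dim {:V})) : V :=
  \sum_i y 0 i *: (vbasis {:V})`_i.

Lemma of_coord_linear (V : vectType K) : linear (@of_coord V).
Proof.
move=> k y z; rewrite /of_coord scaler_sumr -big_split; apply: eq_bigr => i _.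
by rewrite !mxE scalerDl scalerA.
Qed.

Lemma of_lg_coord (G : linearGroup K) (x : G) : of_coord (lg_coord x) = lg_emb x.
Proof. by rewrite -[RHS]vbasis_coordK; apply: eq_bigr => i _; rewrite mxE. Qed.

Section RhoDifferentiable.
Variables (V : normedModType K) (M : V -> idx -> idx -> K) (y : V).
Hypothesis dM : forall a b, differentiable (fun z => M z a b) y.

Lemma differentiable_coef3 t u : differentiable (fun z => coef3 (M z) t u) y.
Proof. by apply: differentiableM; [apply: differentiableM|]; apply: dM. Qed.

Lemma differentiable_coord_rho j :
  differentiable (fun z => coord (vbasis {:'End(P)}) j (rho (M z))) y.
Proof.
rewrite (funext (fun z => coord_lin_comb _ _ j)).
apply: differentiable_fsum => tu; apply: differentiableM.
  exact: differentiable_coef3.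
exact: differentiable_cst.
Qed.

Lemma differentiable_cube T a b c : differentiable (fun z => cube (M z) T a b c) y.
Proof.
rewrite (_ : (fun z => _) = fun z => \sum_u coef3 (M z) (a, b, c) u * T u.1.1
  u.1.2 u.2).
  apply: differentiable_fsum => u; apply: differentiableM.
    exact: differentiable_coef3.
  exact: differentiable_cst.
by apply/funext => z; rewrite cubeE.
Qed.

Definition delta2 (a b x z : idx) : K := ((x == a) && (z == b))%:R.

(** Expansion in matrix units, which makes the coordinates visibly linear in the entries of N. *)
Lemma unchimx_lin_comb (N : idx -> idx -> K) : \val (unchimx N) =
  lin_comb (fun ab => N ab.1 ab.2) (fun ab => \val (unchimx (delta2 ab.1 ab.2))).
Proof.
have s x x' : \sum_(ab : idx * idx) N ab.1 ab.2 * delta2 ab.1 ab.2 x x' = N x x'.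
  rewrite (bigD1 (x, x')) //= /delta2 !eqxx mulr1 big1 ?addr0 // => -[a b].
  by rewrite xpair_eqE [x == a]eq_sym [x' == b]eq_sym => /negPf ->; rewrite mulr0.
apply/ffunP => -[i j]; rewrite /lin_comb sum_ffunE.
transitivity (\sum_ab N ab.1 ab.2 *:
    unchi (fun s t => delta2 ab.1 ab.2 (i, s) (j, t))); last first.
  apply: eq_bigr => ab _; rewrite ffunE; congr (_ *: _).
  by rewrite -[RHS]/(unchimx (delta2 ab.1 ab.2) i j) mxE.
rewrite -[LHS]/(unchimx N i j) mxE; apply: chi_inj => u v.
rewrite unchiK chi_sum -[LHS]s; apply: eq_bigr => ab _.
by rewrite chiZ unchiK.
Qed.

Lemma differentiable_coord_unchimx k : differentiable
  (fun z => coord (vbasis {:{ffun 'I_3 * 'I_3 -> quat K}}) k (\val (unchimx (M z)))) y.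
Proof.
rewrite (funext (fun z => congr1 (coord _ k) (unchimx_lin_comb (M z)))).
rewrite (funext (fun z => coord_lin_comb _ _ k)).
apply: differentiable_fsum => ab.
by apply: differentiableM; [exact: dM | exact: differentiable_cst].
Qed.

End RhoDifferentiable.

Section RecoverDifferentiable.
Variable y : 'rV[K]_(\dim {:'End(P)}).
Local Notation f := (@of_coord 'End(P)).

Lemma differentiable_emb (p : P) a b c : differentiable (fun z => emb (f z p) a b c) y.
Proof.
apply: differentiable_scalar => k z z'.
by rewrite of_coord_linear add_lfunE scale_lfunE emb_linear.
Qed.

Lemma differentiable_contr p q a d :
  differentiable (fun z => contr (emb (f z p)) (emb (f z q)) a d) y.
Proof.
apply: differentiable_fsum => b; apply: differentiableM;
  first exact: differentiable_cst.
apply: differentiable_fsum => c; apply: differentiableM;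
  first exact: differentiable_cst.
by apply: differentiableM; apply: differentiable_emb.
Qed.

Lemma differentiable_cross_sum p q a d :
  differentiable (fun z => cross_sum (f z p) (f z q) a d) y.
Proof.
apply: differentiableM; first exact: differentiable_cst.
by apply: differentiableD; apply: differentiable_contr.
Qed.

Lemma differentiable_col_prod n a d : differentiable (fun z => col_prod (f z) n a d) y.
Proof.
rewrite /col_prod; case: n => i [] /=; last first.
  by apply: differentiableM; [exact: differentiable_cst | exact:
    differentiable_cross_sum].
apply: differentiableD.
  by apply: differentiableM; [exact: differentiable_cst | exact:
    differentiable_cross_sum].
apply: differentiableM; first exact: differentiable_cst.
by apply: differentiableM; [exact: differentiable_cst | exact:
  differentiable_cross_sum].
Qed.

Lemma differentiable_recover a t d n : col_prod (f y) c0 a a != 0 ->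
  emb (f y e3) t.1.1 t.1.2 t.2 != 0 ->
  differentiable (fun z => recover (f z) a t d n) y.
Proof.
move=> ca et; have n2 : 2 != 0 :> K by rewrite pnatr_eq0.
have dc x z : differentiable (fun w => col_scaled (f w) a x z) y.
  apply: differentiableB; first exact: differentiable_col_prod.
  apply: differentiableM.
    by apply: differentiableM; apply: differentiable_col_prod.
  apply: differentiableV; last by rewrite mulf_neq0.
  by apply: differentiableM; [exact: differentiable_cst | exact:
    differentiable_col_prod].
apply: differentiableM.
  apply: differentiableM; first exact: dc.
  exact: (differentiable_cube (M := fun w => col_scaled (f w) a)).
apply: differentiableV.
  apply: differentiableM; first exact: differentiable_emb.
  (* The argument 1 stands for the exponent 2. *)
  apply: (@differentiableX _ _ (fun w => 2^-1 * col_prod (f w) c0 a a) 1).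
  by apply: differentiableM; [exact: differentiable_cst | exact:
    differentiable_col_prod].
by rewrite mulf_neq0 // expf_neq0 // mulf_neq0 // invr_eq0.
Qed.

End RecoverDifferentiable.

End Holomorphy.

(** * The two inverse homomorphisms and their holomorphy *)

Section Isomorphism.
Variable K : numClosedFieldType.
Local Notation P := (freudenthal K).
Local Notation e3 := (e3 K).
Local Notation c0 := ((o0, false) : idx).
Local Notation E7 := (E7R K).
Local Notation Sp := (SpH K 3).

Lemma chimx_val_sympl (A : SpH_type K 3) : sympl (chimx (\val A)).
Proof. exact/chimx_sympl/SpHP. Qed.

Fact to_E7_proof (A : Sp) : `[< preserves (@pcross K) (rho (chimx (\val A))) >].
Proof. exact/asboolP/rho_preserves/chimx_val_sympl. Qed.

Definition to_E7 (A : Sp) : E7 := CrossAut (to_E7_proof A).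

Lemma to_E7_surj (f : E7) : exists A : Sp, to_E7 A = f.
Proof.
have [M sM e] := preserves_image (cross_autP f).
have sA : unchimx M *m qadj (unchimx M) == 1%:M.
  by apply/eqP/chimx_sympl; rewrite unchimxK.
by exists (SpHType sA); apply: val_inj; rewrite /= unchimxK.
Qed.

(** The preimage is chosen abstractly; injectivity of [rho] makes it unique, and holomorphy comes
    from [recover], which computes it near each point. *)
Definition to_Sp (f : E7) : Sp := projT1 (cid (to_E7_surj f)).

Lemma to_SpK : cancel to_Sp to_E7.
Proof. by move=> f; rewrite /to_Sp; case: cid. Qed.

Lemma to_E7_inj : injective to_E7.
Proof.
move=> A B /(congr1 val) /= /(rho_inj (chimx_val_sympl A) (chimx_val_sympl B)) e.
by apply: val_inj; rewrite -[LHS]chimxK -[RHS]chimxK e.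
Qed.

Lemma to_E7K : cancel to_E7 to_Sp.
Proof. by move=> A; apply: to_E7_inj; rewrite to_SpK. Qed.

Lemma to_E7M : {morph to_E7 : A B / (A * B)%g}.
Proof.
move=> A B; apply: val_inj; rewrite /= -rho_mul ?chimxM //.
exact: chimx_val_sympl.
Qed.

Lemma to_SpM : {morph to_Sp : f g / (f * g)%g}.
Proof. by move=> f g; apply: to_E7_inj; rewrite to_E7M !to_SpK. Qed.

Lemma to_E7_holomorphic : holomorphic to_E7.
Proof.
(* [chimx] and [rho] make sense for arbitrary matrices, so a single polynomial extension works at
   all points. *)
move=> A; pose M (y : 'rV[K]_(\dim {:lg_space Sp})) := chimx (Matrix (of_coord y)).
exists (fun y => \row_i coord (vbasis {:'End(P)}) i (rho (M y))); split.
  near=> y; apply: differentiable_row => i.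
  apply: differentiable_coord_rho => -[j s] [k t].
  apply: differentiable_scalar => c z z'.
  by rewrite /M /chimx of_coord_linear /fun_of_matrix /= !ffunE chiD chiZ.
near=> y => B <-; apply/rowP => i; rewrite [LHS]mxE [RHS]mxE.
have -> // : M (lg_coord B) = chimx (\val B).
by rewrite /M of_lg_coord; congr chimx; apply: val_inj.
Unshelve. all: by end_near. Qed.

Lemma to_Sp_holomorphic : holomorphic to_Sp.
Proof.
move=> f; pose M := chimx (\val (to_Sp f)).
have sM : sympl M by exact: chimx_val_sympl.
have eM (h : E7) : rho (chimx (\val (to_Sp h))) = \val h.
  by rewrite -[in RHS](to_SpK h).
(* The row a and the minor t are chosen nonzero at f; the denominators of the formula then stay
   nonzero on a neighbourhood. *)
have [a na] := sympl_col_neq0 c0 sM.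
have [t nt] := emb_neq0 (rho_e3_neq0 sM).
pose D (y : 'rV[K]_(\dim {:lg_space E7})) := of_coord y : 'End(P).
have Df : D (lg_coord f) = rho M by rewrite /D of_lg_coord eM.
have nearD : \forall y \near lg_coord f, col_prod (D y) c0 a a != 0 /\
    emb (D y e3) t.1.1 t.1.2 t.2 != 0.
  apply: filterI.
    apply: (near_differentiable_neq0 (h := fun y => col_prod (D y) c0 a a)).
      exact: differentiable_col_prod.
    by rewrite Df col_prod_rho // -mulr2n mulrn_eq0 /= mulf_neq0.
  apply: (near_differentiable_neq0 (h := fun y => emb (D y e3) t.1.1 t.1.2 t.2)).
    exact: differentiable_emb.
  by rewrite Df.
exists (fun y => \row_i coord (vbasis {:lg_space Sp}) i (\val (unchimx (recover
  (D y) a t)))).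
split.
  apply: filterS nearD => y [ny ny']; apply: differentiable_row => i.
  apply: differentiable_coord_unchimx => d n; exact: differentiable_recover.
apply: filterS nearD => y [ny ny'] h ey; apply/rowP => i; rewrite !mxE.
congr (coord _ _ _); rewrite -[RHS]/(\val (\val (to_Sp h))); congr (\val _).
have sh : sympl (chimx (\val (to_Sp h))) by exact: chimx_val_sympl.
have Dh : D y = rho (chimx (\val (to_Sp h))) by rewrite /D -ey of_lg_coord eM.
have nh : chimx (\val (to_Sp h)) a c0 != 0.
  apply/eqP => z; move: ny; rewrite Dh col_prod_rho // z mulr0 addr0.
  by rewrite eqxx.
rewrite -[RHS]chimxK; congr unchimx; apply/funext => d; apply/funext => n.
by move: ny'; rewrite Dh => ny'; apply: recover_rho.
Qed.

Lemma E7R_SpH_isomorphic : lie_isomorphic E7 Sp.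
Proof.
exists to_Sp, to_E7; split.
- exact: to_SpM.
- exact: to_SpK.
- exact: to_E7K.
- exact: to_Sp_holomorphic.
- exact: to_E7_holomorphic.
Qed.

End Isomorphism.

Theorem theorem5p10 (R : realType) : lie_isomorphic (E7R R[i]) (SpH R[i] 3).
Proof. exact: E7R_SpH_isomorphic. Qed.
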